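(* Let $K$ be a compact convex set with $\mathrm{conv}\{0,e_1,\dots,e_d\}\subset K\subset[0,1]^d$. Then the function $$C(u_1,\dots,u_d)=\exp\{-h(K,(-\log u_1,\dots,-\log u_d))\},\quad u\in(0,1]^d,$$ extended by $0$ when some $u_i=0$, is a copula if and only if $K$ is a max-zonoid.
   Context: The support function is $h(K,x)=\sup_{y\in K}\langle y,x\rangle$. A copula is the cumulative distribution function on $[0,1]^d$ of a random vector with uniform $[0,1]$ marginals. Fix a reference norm on $\mathbb{R}^d$ with $\mathbb{S}=\{x\in[0,\infty)^d:\|x\|=1\}$. A compact convex $K\subset[0,\infty)^d$ is a max-zonoid if $h(K,x)=\int_{\mathbb{S}}\max_i(a_ix_i)\,\sigma(da)$ for all $x\in[0,\infty)^d$, for some nonzero finite Borel measure $\sigma$ on $\mathbb{S}$. *)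

(* Defs.v *)
From HB Require Import structures.
From mathcomp Require Import all_boot all_order all_algebra.
From mathcomp Require Import all_classical all_reals all_analysis.
Set Implicit Arguments. Unset Strict Implicit. Unset Printing Implicit Defensive.
Import Order.TTheory GRing.Theory Num.Theory.
Import numFieldNormedType.Exports.
Local Open Scope classical_set_scope.
Local Open Scope ring_scope.

Section Defs.
Variables (R : realType) (d : nat).
Notation V := 'rV[R]_d.

Definition conv_hull_set (A : set V) : set V :=
  [set x | forall C : set V, convex.convex_set C -> A `<=` C -> C x].

Definition simplex_vertices : set V :=
  [set 0] `|` range (fun i : 'I_d => delta_mx 0 i).

Definition unit_cube : set V := [set u | forall i, 0 <= u 0 i <= 1].

Definition orthant : set V := [set x | forall i, 0 <= x 0 i].

Definition support_fun (K : set V) (x : V) : R :=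
  sup [set \sum_(i < d) y 0 i * x 0 i | y in K].

Definition is_norm (N : V -> R) : Prop :=
  [/\ forall x, N x = 0 -> x = 0,
      forall (a : R) x, N (a *: x) = `|a| * N x &
      forall x y, N (x + y) <= N x + N y].

Definition borelV := g_sigma_algebraType (@open V).

Definition ref_sphere (N : V -> R) : set V := [set x | orthant x /\ N x = 1].

(* max-zonoid w.r.t. the reference norm N: h(K,x) = int_S max_i (a_i x_i) sigma(da)
   for a nonzero finite Borel measure sigma on S (represented as a Borel measure
   on R^d carried by S) *)
Definition max_zonoid (N : V -> R) (K : set V) : Prop :=
  exists sigma : {measure set borelV -> \bar R},
    [/\ sigma setT < +oo,
        sigma (~` ref_sphere N) = 0,
        sigma (ref_sphere N) != 0 &
        forall x, orthant x ->
          (support_fun K x)%:E =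
          \int[sigma]_(a in (ref_sphere N : set borelV))
             (\big[Num.max/0]_(i < d) (a 0 i * x 0 i))%:E]%E.

Definition copula_candidate (K : set V) (u : V) : R :=
  if `[< exists i, u 0 i = 0 >] then 0
  else expR (- support_fun K (\row_(i < d) (- ln (u 0 i)))).

Definition is_copula (C : V -> R) : Prop :=
  exists (dsp : measure_display) (T : measurableType dsp) (P : probability T R)
         (X : 'I_d -> T -> R),
    [/\ forall i, measurable_fun setT (X i),
        forall i (t : R), P [set w | X i w <= t] = (Num.min (Num.max t 0) 1)%:E &
        forall u, unit_cube u -> (C u)%:E = P [set w | forall i, X i w <= u 0 i]].

End Defs.

(* Main.v *)
(** If [h(K, x)] is the integral of [max_i a_i x_i], then for a measure with finitely many atoms
    [exp (- h (K, x))] is the survival function of a vector of minima of independent exponential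
    variables, that is, [C] is the distribution function of a vector of maxima of powers of
    independent uniform variables. A general [sigma] is approximated by finite ones, and the laws
    obtained have a limit point.

    Conversely, let [X] have distribution function [C] and put [A_i = 1 / (- ln X_i)]. Homogeneity
    of [h] says that [M_x = max_i A_i x_i] has the law of [h(K, x) * M_(e_1)], where [M_(e_1)] has
    finite moments of order [p < 1]. Hence, under the probability with density proportional to
    [N(A)^p], the direction [A / N(A)] satisfies
    [E (max_i x_i A_i / N(A))^p = h(K, x)^p * r_p]. A limit point of these laws on the sphere as
    [p] tends to 1 is, up to a scalar, the required spectral measure.

    Limit points of laws on [[0, B]^d] exist because the masses of the cells of a bisection
    converge along an ultrafilter, and any consistent family of masses is realised on [[0, 1[]
    by nested intervals. *)
Require Import Defs.
From HB Require Import structures.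
From mathcomp Require Import all_boot all_order all_algebra.
From mathcomp Require Import all_classical all_reals all_analysis.
From mathcomp Require Import measurable_realfun ring lra.
Set Implicit Arguments. Unset Strict Implicit. Unset Printing Implicit Defensive.
Import Order.TTheory GRing.Theory Num.Theory.
Import numFieldNormedType.Exports.
Local Open Scope classical_set_scope.
Local Open Scope ring_scope.

(** * Borel sets of vectors *)

Section BorelVectors.
Context {R : realType} {d : nat}.
Notation V := 'rV[R]_d.

(** The limits of the cell masses need not be the masses that the limit law gives to the cells,
    since mass may accumulate on cell boundaries. Only integrals of Lipschitz functions pass to the
    limit, and every property to be preserved is put in that form: distribution functions are
    squeezed between Lipschitz ramps, and being carried by the sphere becomes a vanishing integral
    of [|N a - 1|]. The ramps cost a small shift of the argument, which is harmless because [C] is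
    1-Lipschitz in each coordinate: [K] inside the cube bounds the growth of [h], and [e_i] in [K]
    gives [C u <= u_i]. Exponents [p < 1] are forced because [M_(e_1)] has distribution function
    [exp (- 1 / t)], whose mean is infinite, so that tilting by [N(A)] itself is impossible. The
    constant [r_p] is eliminated by comparing [x] with [e_1], where [h] is 1; the price of replacing
    [m^p] by [m] on a bounded interval is a multiple of [1 - p]. The comparison then concerns a
    fixed Lipschitz function that does not depend on [p]. *)

Definition lipschitz_sup (k : R) (f : V -> R) :=
  forall (x y : V) (e : R), (forall i, `|x 0 i - y 0 i| <= e) -> `|f x - f y| <= k * e.

Definition box (B : R) : set V := [set x | forall i, 0 <= x 0 i <= B].

Lemma continuous_measurable_borelV (f : V -> R) :
  continuous f -> measurable_fun setT (f : borelV R d -> R).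
Proof.
move=> cf; apply: (measurability _ (RGenOInfty.measurableE R)) => _ [_ [a ->] <-].
rewrite setTI; apply: sub_sigma_algebra.
by move/continuousP : cf; apply; exact: interval_open.
Qed.

Lemma measurable_coord i :
  measurable_fun setT (fun x : borelV R d => (x : V) 0 i).
Proof. by apply: continuous_measurable_borelV; exact: coord_continuous. Qed.

Lemma lipschitz_sup_continuous k f : lipschitz_sup k f -> continuous f.
Proof.
move=> lf x; apply/(@cvgrPdist_le _ _ _ (nbhs x) _) => e e0.
have k0 : 0 < `|k| + 1 by rewrite ltr_wpDl.
apply/nbhs_ballP; exists (e / (`|k| + 1)) => /=; first exact: divr_gt0.
move=> y [_ xy]; rewrite (le_trans (lf x y (e / (`|k| + 1)) _))//.
  by move=> i; exact/ltW/xy.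
rewrite (@le_trans _ _ ((`|k| + 1) * (e / (`|k| + 1))))//.
  rewrite ler_wpM2r ?divr_ge0 ?(ltW e0) ?(ltW k0)//.
  by rewrite (le_trans (ler_norm k))// lerDl.
by rewrite mulrC divfK// gt_eqF.
Qed.

Lemma lipschitz_sup_measurable k f : lipschitz_sup k f ->
  measurable_fun setT (f : borelV R d -> R).
Proof.
by move=> lf; apply: continuous_measurable_borelV; exact: lipschitz_sup_continuous lf.
Qed.

(** Every open set is a countable union of open cubes with rational centre and radius [1 / (n + 1)],
    and the preimage of a cube is described by finitely many coordinates. *)
Lemma measurable_borelV dsp (T : measurableType dsp) (X : T -> V) :
  (forall i, measurable_fun setT (fun t => X t 0 i)) ->
  measurable_fun setT (X : T -> borelV R d).
Proof.
move=> mX; apply: (@measurability _ _ _ (borelV R d) setT X (@open V) erefl).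
move=> _ [U oU <-]; rewrite setTI.
pose b (q : 'rV[rat]_d * nat) : set V :=
  [set x | forall i, `|ratr (q.1 0 i) - x 0 i| < q.2.+1%:R^-1].
have -> : U = \bigcup_(q in [set q | b q `<=` U]) b q.
  apply/seteqP; split => [x Ux|x [q qU /qU]//].
  have /nbhs_ballP[e /= e0 xeU] := open_nbhs_nbhs (conj oU Ux).
  have [n ne] : exists n : nat, n.+1%:R^-1 < e / 2.
    have [n _ nP] := near_infty_natSinv_lt (PosNum (divr_gt0 e0 (ltr0n _ 2))).
    by exists n; exact: nP (leqnn n).
  have n0 : (0 : R) < n.+1%:R^-1 by rewrite invr_gt0.
  have : forall i, exists q : rat, `|ratr q - x 0 i| < n.+1%:R^-1.
    move=> i; have [|q] := @rat_in_itvoo R (x 0 i - n.+1%:R^-1) (x 0 i + n.+1%:R^-1).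
      by rewrite ltrBlDr -addrA ltrDl addr_gt0.
    rewrite in_itv/= => /andP[q1 q2]; exists q.
    by rewrite ltr_norml ltrBrDr addrC q1 ltrBlDl.
  move=> /choice[q qP]; exists (\row_i q i, n); last first.
    by move=> i /=; rewrite mxE.
  move=> y /= yq; apply: xeU; split => // i j; rewrite !ord1.
  have := yq j; rewrite mxE => yj; have xj := qP j.
  rewrite -ball_normE/= (@le_lt_trans _ _ (`|ratr (q j) - y 0 j| + `|ratr (q j) - x 0 j|))//.
    rewrite [leRHS]addrC (distrC (ratr _) (x 0 j)).
    by rewrite (le_trans _ (ler_normD _ _))// subrKA.
  by rewrite (lt_trans (ltrD yj xj))// [ltRHS](splitr e) ltrD.
(* The union over the cubes contained in [U] becomes a union over the whole countable index type,
   the other indices contributing the empty set. *)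
rewrite preimage_bigcup (_ : \bigcup_(_ in _) _ =
    \bigcup_q (if `[< b q `<=` U >] then X @^-1` b q else set0)); last first.
  apply/seteqP; split => t [q /= qU qt]; exists q => //=.
    by rewrite asboolT.
  - by move: qt; case: asboolP.
  - by move: qt; case: asboolP.
apply: countable_bigcupT_measurable => // q; case: asboolP => // _.
rewrite (_ : X @^-1` b q =
    \bigcap_(i in [set: 'I_d]) [set t | `|ratr (q.1 0 i) - X t 0 i| < q.2.+1%:R^-1]).
  apply: fin_bigcap_measurable => // i _.
  rewrite [X in measurable X](_ : _ = [set t | (fun t => `|ratr (q.1 0 i) - X t 0 i|) t < q.2.+1%:R^-1])//.
  rewrite -[X in measurable X]setTI; apply: measurable_fun_ltr => //.
  apply: measurableT_comp => //; exact: measurable_funB.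
by apply/seteqP; split => t /= tq i; [move=> _|]; exact: tq.
Qed.

End BorelVectors.

(** * Bisection and limits of laws *)

Section FiniteMeasure.
Context dsp {T : measurableType dsp} {R : realType}.
Variables (mu : {measure set T -> \bar R}) (D : set T).
Hypotheses (mD : measurable D) (muD : (mu D < +oo)%E).

Lemma bounded_integrable (f : T -> R) (M : R) : measurable_fun D f ->
  (forall t, D t -> `|f t| <= M) -> mu.-integrable D (EFin \o f).
Proof.
move=> mf fM; apply: measurable_bounded_integrable => //.
by exists M; split; [exact: num_real|move=> x Mx t /fM /le_trans; apply; exact: ltW].
Qed.

Lemma Rintegral_sum (I : Type) (s : seq I) (f : I -> T -> R) :
  (forall i, mu.-integrable D (EFin \o f i)) ->
  \int[mu]_(t in D) (\sum_(i <- s) f i t) = \sum_(i <- s) \int[mu]_(t in D) f i t.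
Proof.
move=> fi; elim: s => [|i s ih].
  by under eq_Rintegral do rewrite big_nil; rewrite Rintegral_cst// mul0r big_nil.
under eq_Rintegral do rewrite big_cons.
rewrite RintegralD//; first by rewrite big_cons ih.
rewrite (_ : _ \o _ = (fun t => (\sum_(j <- s) (EFin \o f j) t)%E)); last first.
  by apply/funext => t /=; rewrite sumEFin.
exact: integrable_sum.
Qed.

Lemma le_dist_Rintegral (f g : T -> R) (e : R) :
  mu.-integrable D (EFin \o f) -> mu.-integrable D (EFin \o g) ->
  (forall t, D t -> `|f t - g t| <= e) ->
  `|\int[mu]_(t in D) f t - \int[mu]_(t in D) g t| <= e * fine (mu D).
Proof.
move=> fi gi fg; rewrite -RintegralB//.
have fgi : mu.-integrable D (EFin \o (fun t => f t - g t)).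
  by have := integrableB mD fi gi; apply: eq_integrable.
rewrite (le_trans (le_normr_Rintegral _ _))//.
rewrite -Rintegral_cst//; apply: le_Rintegral => //.
- exact: integrable_norm.
- apply: (@bounded_integrable _ `|e|) => //; exact: measurable_cst.
Qed.

End FiniteMeasure.

(** * Adaptive binary tests and the words of their answers *)

Section BitPaths.
Context dsp {T : measurableType dsp} {R : realType}.
Variable test : seq bool -> T -> bool.
Hypothesis mtest : forall w, measurable [set t | test w t].

(** Each test may depend on the answers already given. The same words index the cells of the box and
    the subintervals of [[0, 1[], which is how masses are carried from one to the other. *)
Fixpoint path_of (n : nat) (t : T) : seq bool :=
  if n is m.+1 then test (path_of m t) t :: path_of m t else [::].

Lemma size_path_of n t : size (path_of n t) = n.
Proof. by elim: n => //= n ->. Qed.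

Lemma measurable_path_of n w : measurable [set t | path_of n t = w].
Proof.
elim: n w => [|n ih] [|b w] /=.
- by rewrite (_ : [set _ | _] = setT)//; apply/seteqP; split.
- by rewrite (_ : [set _ | _] = set0)//; apply/seteqP; split => // t.
- by rewrite (_ : [set _ | _] = set0)//; apply/seteqP; split => // t.
rewrite (_ : [set _ | _] = [set t | path_of n t = w] `&`
    (if b then [set t | test w t] else ~` [set t | test w t])).
  by apply: measurableI => //; case: b => //; exact: measurableC.
apply/seteqP; split => t /=.
  by case=> <- <-; split => //; case: ifPn => //= /negP.
by case=> -> wb; congr cons; move: wb; case: b => //= /negP/negbTE.
Qed.

(** A function of the first [n] answers is a simple function; its measurability and its integral
    both follow from this decomposition. *)
Lemma fun_path_ofE n (phi : seq bool -> R) t :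
  phi (path_of n t) =
  \sum_(w : n.-tuple bool) phi w * \1_[set t | path_of n t = w] t.
Proof.
have sz : size (path_of n t) == n by rewrite size_path_of.
rewrite (bigD1 (Tuple sz))//= indicE mem_set// mulr1 big1 ?addr0// => w wt.
rewrite indicE memNset ?mulr0//= => tw; move/eqP: wt; apply.
exact: val_inj.
Qed.

Lemma measurable_fun_path_of n (phi : seq bool -> R) :
  measurable_fun setT (fun t => phi (path_of n t)).
Proof.
under eq_fun do rewrite (fun_path_ofE n).
apply: measurable_sum => w; apply: measurable_funM => //.
by apply: measurable_indic; exact: measurable_path_of.
Qed.

Variables (mu : {measure set T -> \bar R}) (D : set T).
Hypotheses (mD : measurable D) (muD : (mu D < +oo)%E).

Lemma integrable_path_of n (phi : seq bool -> R) :
  mu.-integrable D (EFin \o (fun t => phi (path_of n t))).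
Proof.
apply: (@bounded_integrable _ _ _ _ _ _ _ _
    (\sum_(w : n.-tuple bool) `|phi w|)) => //.
  by apply: measurable_funTS; exact: measurable_fun_path_of.
move=> t _; rewrite (fun_path_ofE n) (le_trans (ler_norm_sum _ _ _))//.
apply: ler_sum => w _; rewrite normrM indicE ler_piMr//.
by case: (_ \in _); rewrite ?normr1 ?normr0.
Qed.

Lemma Rintegral_path_of n (phi : seq bool -> R) :
  \int[mu]_(t in D) phi (path_of n t) =
  \sum_(w : n.-tuple bool) phi w * fine (mu (D `&` [set t | path_of n t = w])).
Proof.
under eq_Rintegral do rewrite (fun_path_ofE n).
rewrite Rintegral_sum//; last first.
  move=> w; apply: (@bounded_integrable _ _ _ _ _ _ _ _ `|phi w|) => //.
    apply: measurable_funM => //; apply: measurable_indic.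
    exact: measurable_path_of.
  move=> t _; rewrite normrM indicE ler_piMr//.
  by case: (_ \in _); rewrite ?normr1 ?normr0.
apply: eq_bigr => w _; rewrite RintegralZl//; last first.
  apply: (@bounded_integrable _ _ _ _ _ _ _ _ 1) => //.
    by apply: measurable_indic; exact: measurable_path_of.
  by move=> t _; rewrite indicE; case: (_ \in _); rewrite ?normr1 ?normr0.
congr (_ * _); rewrite /Rintegral integral_indic//; first by rewrite setIC.
exact: measurable_path_of.
Qed.

(** This additivity is the only constraint on a family of masses that the interval tree requires
    beyond sign and total mass, and it survives limits. *)
Lemma mass_path_of_cons n w :
  mu (D `&` [set t | path_of n t = w]) =
  (mu (D `&` [set t | path_of n.+1 t = false :: w]) +
   mu (D `&` [set t | path_of n.+1 t = true :: w]))%E.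
Proof.
have mP m v : measurable (D `&` [set t | path_of m t = v]).
  by apply: measurableI => //; exact: measurable_path_of.
rewrite -measureU//; first last.
- by apply/seteqP; split => // t [[_ /= [-> _]] [_ /= []]].
congr (mu _); apply/seteqP; split => t /=.
  by case=> Dt <-; case: (test _ t); [right|left].
by case=> -[Dt [_ ->]].
Qed.

End BitPaths.

(* Nodes of the binary tree are words whose head is the most recent bit; a consistent mass
   on the tree is realised by nested subintervals of [0, 1[ whose lengths are the masses. *)
Section IntervalTree.
Context {R : realType}.
Variable m : seq bool -> R.
Hypotheses (m_ge0 : forall w, 0 <= m w) (m_nil : m [::] = 1)
  (m_cons : forall w, m w = m (false :: w) + m (true :: w)).

Fixpoint left_end (w : seq bool) : R :=
  if w is b :: v then left_end v + (if b then m (false :: v) else 0) else 0.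

Definition right_half (w : seq bool) (t : measurableTypeR R) : bool :=
  left_end w + m (false :: w) <= t.

Lemma measurable_right_half w : measurable [set t | right_half w t].
Proof.
rewrite [X in measurable X](_ : _ = `[left_end w + m (false :: w), +oo[%classic)//.
by apply/seteqP; split => t /=; rewrite in_itv/= andbT.
Qed.

Lemma path_right_halfP n w t : 0 <= t < 1 -> size w = n ->
  path_of right_half n t = w <-> left_end w <= t < left_end w + m w.
Proof.
move=> t01; elim: n w => [|n ih] [|b w]//=.
  by move=> _; rewrite m_nil add0r t01; split.
move=> [wn]; split.
  case=> bE /[dup] pw /(ih _ wn) /andP[lt tr]; move: bE.
  rewrite pw /right_half; case: b => [tt|/negbT]; first by rewrite tt -addrA -m_cons.
  by rewrite -ltNge addr0 lt => ->.
move=> /andP[lt tr].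
have pw : path_of right_half n t = w.
  apply/(ih _ wn); have := m_cons w; have := m_ge0 (false :: w).
  have := m_ge0 (true :: w); move: lt tr.
  by case: b => lt tr m1 m0 mE; apply/andP; split; lra.
rewrite pw; congr cons; rewrite /right_half; move: lt tr.
by case: b => //; rewrite addr0 => _ ?; apply/negbTE; rewrite -ltNge.
Qed.

Lemma mass_right_half w : left_end w + m w <= 1 /\ 0 <= left_end w.
Proof.
elim: w => [|b w [ih1 ih2]] /=; first by rewrite m_nil add0r.
have := m_cons w; have := m_ge0 (false :: w); have := m_ge0 (true :: w).
by case: b => m1 m0 mE; split; lra.
Qed.

Lemma lebesgue_path_right_half n w : size w = n ->
  lebesgue_measure (`[0%R, 1%R[%classic `&` [set t | path_of right_half n t = w]) =
  (m w)%:E.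
Proof.
move=> wn; have [l1 l0] := mass_right_half w.
rewrite [X in lebesgue_measure X](_ : _ = `[left_end w, left_end w + m w[%classic).
  rewrite lebesgue_measure_itv/= lte_fin ltrDl.
  case: ltP => [_|m0]; first by rewrite -EFinD addrAC subrr add0r.
  by congr EFin; apply/eqP; rewrite eq_le m_ge0 m0.
apply/seteqP; split => t /=; rewrite !in_itv/=.
  by case=> t01 /(path_right_halfP t01 wn).
move=> lt; have t01 : 0 <= t < 1.
  by move/andP : lt => [lt tl]; rewrite (le_trans l0 lt) (lt_le_trans tl l1).
by split => //; exact/path_right_halfP.
Qed.

End IntervalTree.

(* Bisection of the box [0, B]^d, the coordinates being halved cyclically. *)
Section Bisection.
Context {R : realType} {d : nat}.
Hypothesis d0 : (0 < d)%N.
Variable B : R.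
Hypothesis B0 : 0 <= B.
Notation V := 'rV[R]_d.

Definition split_coord (n : nat) : 'I_d := Ordinal (ltn_pmod n d0).

Fixpoint width (n : nat) (i : 'I_d) : R :=
  if n is k.+1 then (if i == split_coord k then width k i / 2 else width k i)
  else B.

(** The lower corner of the cell of [w]; the level, hence the coordinate being halved, is read off
    from the length of the word. *)
Fixpoint corner (w : seq bool) (i : 'I_d) : R :=
  if w is b :: v then
    corner v i + (if b && (i == split_coord (size v)) then width (size v) i / 2 else 0)
  else 0.

Lemma width_ge0 n i : 0 <= width n i.
Proof. by elim: n => //= n ih; case: ifP => // _; rewrite divr_ge0. Qed.

Lemma width_block n k i : (k <= d)%N ->
  width (k + n * d) i = B / 2 ^+ n * (if (i < k)%N then 2^-1 else 1).
Proof.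
elim: n k => [|n ih]; elim=> [|k ihk] kd.
- by rewrite ltn0 mul0n addn0 /= expr0 invr1 !mulr1.
- rewrite addSn /= ihk ?(ltnW kd)//.
  rewrite -val_eqE /= mul0n addn0 modn_small// ltnS.
  by case: ltngtP; rewrite ?mulr1//; lra.
(* The start [k = 0] of a round is the end [k = d] of the previous one, where all coordinates have
   been halved once more. *)
- rewrite add0n mulSn ih// ltn_ord ltn0 mulr1 exprSr invfM mulrA//.
rewrite addSn /= ihk ?(ltnW kd)//.
rewrite -val_eqE /= addnC modnMDl modn_small// ltnS.
by case: ltngtP; rewrite ?mulr1//; lra.
Qed.

Lemma width_small e : 0 < e -> exists n, forall i, width n i <= e.
Proof.
move=> e0; have [n Bn] : exists n, B / 2 ^+ n <= e.
  have [n Bn] : exists n, B / e < n%:R.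
    by exists (Num.bound (B / e)); rewrite archi_boundP// divr_ge0// ltW.
  exists n; rewrite ler_pdivrMr ?exprn_gt0// mulrC -ler_pdivrMr//.
  rewrite (le_trans (ltW Bn))// -natrX ler_nat ltnW//; exact: ltn_expl.
by exists (n * d)%N => i; rewrite -[X in width X]add0n width_block// ltn0 mulr1.
Qed.

Lemma corner_cons b w i :
  corner w i <= corner (b :: w) i /\
  corner (b :: w) i + width (size w).+1 i <= corner w i + width (size w) i.
Proof.
have w0 := width_ge0 (size w) i.
by rewrite /=; case: (i == _); case: b => /=; split; lra.
Qed.

Lemma corner_bounds w i : 0 <= corner w i /\ corner w i + width (size w) i <= B.
Proof.
elim: w => [|b w [ih1 ih2]]; first by rewrite /= add0r.
have [c1 c2] := corner_cons b w i; split; first exact: le_trans c1.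
exact: le_trans ih2.
Qed.

Definition upper_half (w : seq bool) (x : borelV R d) : bool :=
  let i := split_coord (size w) in corner w i + width (size w) i / 2 < (x : V) 0 i.

Lemma measurable_upper_half w : measurable [set x | upper_half w x].
Proof.
rewrite /upper_half -[X in measurable X]setTI.
by apply: measurable_fun_ltr => //; exact: measurable_coord.
Qed.

Lemma corner_path_of n (x : V) i : box B x ->
  corner (path_of upper_half n x) i <= x 0 i <=
  corner (path_of upper_half n x) i + width n i.
Proof.
move=> xB; elim: n => [|n /andP[ih1 ih2]] /=; first by rewrite add0r xB.
have w0 := width_ge0 n i.
rewrite size_path_of {2 5}/upper_half size_path_of.
case: eqVneq => [<-|_]; last by rewrite andbF addr0 ih1.
rewrite andbT; case: ltP => h; apply/andP; split; lra.
Qed.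

End Bisection.

(** * Image laws and change of variables *)

Section Laws.
Context {R : realType} {dsp dsp' : measure_display}.
Context {T : measurableType dsp} {T' : measurableType dsp'}.

Lemma law_exists (P : probability T R) (X : T -> T') : measurable_fun setT X ->
  exists Q : probability T' R, forall A, Q A = P (X @^-1` A).
Proof.
move=> mX; pose X' : {mfun T >-> T'} := mfun_Sub (mem_set mX).
by exists (distribution P X').
Qed.

Lemma Rintegral_law (P : probability T R) (X : T -> T') (Q : probability T' R)
    (f : T' -> R) (D : set T') (M : R) :
  measurable_fun setT X -> (forall A, Q A = P (X @^-1` A)) ->
  measurable D -> measurable_fun setT f -> (forall t, D (X t)) ->
  (forall y, D y -> `|f y| <= M) ->
  \int[Q]_(y in D) f y = \int[P]_t f (X t).
Proof.
move=> mX QE mD mf DX fM; rewrite /Rintegral.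
pose X' : {mfun T >-> T'} := mfun_Sub (mem_set mX).
have -> : (\int[Q]_(y in D) (f y)%:E = \int[distribution P X']_(y in D) (f y)%:E)%E.
  by apply: eq_measure_integral => A mA _; exact: QE.
have XD : X @^-1` D = setT by apply/seteqP; split => // t _; exact: DX.
rewrite /distribution integral_pushforward//; last 2 first.
- exact/measurable_EFinP.
- rewrite /= XD; apply: (@bounded_integrable _ _ _ _ _ _ _ (f \o X) M) => //.
  + exact: le_lt_trans (probability_le1 P measurableT) (ltry 1).
  + exact: measurableT_comp.
  + by move=> t _; exact: fM.
by rewrite /= XD.
Qed.

End Laws.

Section UniformOnUnitInterval.
Context {R : realType}.

(** The uniform density lives on the closed interval whereas nested intervals are half-open; the two
    agree because the point 1 is null. *)
Lemma uniform_prob01E (A : set (measurableTypeR R)) : measurable A ->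
  uniform_prob (@ltr01 R) A = lebesgue_measure (`[0%R, 1%R[%classic `&` A).
Proof.
move=> mA; rewrite /uniform_prob integral_uniform_pdf.
under eq_integral.
  move=> x; rewrite inE/= in_itv/= => -[_ x01].
  rewrite /uniform_pdf x01 subr0 invr1.
  over.
have mI : measurable (A `&` `[0%R, 1%R]) by exact: measurableI.
rewrite integral_cst//= mul1e; apply/eqP; rewrite eq_le; apply/andP; split.
  have m0 : measurable (`[0%R, 1%R[%classic `&` A) by exact: measurableI.
  apply: (@le_trans _ _ (lebesgue_measure ((`[0%R, 1%R[%classic `&` A) `|` [set 1%R]))).
    apply: le_measure; rewrite ?inE//; first exact: measurableU.
    move=> t /= [At]; rewrite !in_itv/= => /andP[-> t1].
    by move: t1; rewrite le_eqVlt => /predU1P[->|->]; [right|left].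
  apply: (le_trans (measureU2 _ _ _)) => //.
  rewrite -[leRHS]adde0; apply: leeD => //.
  by rewrite le_eqVlt; apply/orP; left; apply/eqP; exact: lebesgue_measure_set1.
apply: le_measure; rewrite ?inE//; first exact: measurableI.
by move=> t /= [+ At]; rewrite !in_itv/= => /andP[-> /ltW ->].
Qed.

End UniformOnUnitInterval.

(** The image of an ultrafilter is an ultrafilter, and it converges in a compact interval. A single
    ultrafilter thus makes all cell masses converge at once, without a diagonal extraction. *)
Lemma ultra_cvg_itv {R : realType} (F : set_system nat) (u : nat -> R) (a b : R) :
  UltraFilter F -> (forall k, a <= u k <= b) -> exists2 l, a <= l <= b & u @ F --> l.
Proof.
move=> FU uab.
have UFu : UltraFilter (u @ F).
  split; first exact: fmap_proper_filter.
  move=> G PG uG; apply/seteqP; split => A; last exact: uG.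
  have [//|nFA] := in_ultra_setVsetC (u @^-1` A) FU.
  move=> GA; exfalso; have GC : G (~` A) by apply: uG.
  by apply: (@filter_not_empty _ G); rewrite -(setICr A); exact: filterI.
have : compact `[a, b] by exact: segment_compact.
rewrite compact_ultra => /(_ (u @ F) UFu)[].
  by apply: (@filterE _ F) => k /=; rewrite in_itv/=.
by move=> l [] /=; rewrite in_itv/= => lab ul; exists l.
Qed.

(** * Existence of limit laws on a box *)

Section Selection.
Context {R : realType} {d : nat}.
Hypothesis d0 : (0 < d)%N.
Variable B : R.
Hypothesis B0 : 0 <= B.
Notation V := 'rV[R]_d.

Definition corner_vec (w : seq bool) : V := \row_i corner d0 B w i.

Lemma measurable_box : measurable (box B : set (borelV R d)).
Proof.
rewrite (_ : box B = \bigcap_(i in [set: 'I_d]) [set x : borelV R d | 0 <= (x : V) 0 i <= B]).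
  apply: fin_bigcap_measurable => // i _; rewrite -[X in measurable X]setTI.
  have := @measurable_coord R d i measurableT `[0%R, B]%classic (measurable_itv _).
  by congr (measurable (_ `&` _)); apply/seteqP; split => x /=; rewrite in_itv.
by apply/seteqP; split => x xB i; [move=> _|]; exact: xB.
Qed.

Lemma lipschitz_sup_bounded k f (x : V) : lipschitz_sup k f -> box B x ->
  `|f x| <= `|f 0| + k * B.
Proof.
move=> fk xB; rewrite -[f x](subrK (f 0)) (le_trans (ler_normD _ _))// addrC lerD2l.
by apply: fk => i; rewrite mxE subr0; have /andP[x0 xb] := xB i; rewrite ger0_norm.
Qed.

(** A Riemann sum over words, with [f] evaluated at the corners. It is used twice: for the identity
    on the box, where the words locate the point itself, and for the branch limit on [[0, 1[], where
    they come from the interval tree. *)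
Lemma path_approximation dsp (T : measurableType dsp) (mu : {measure set T -> \bar R})
    (D : set T) (X : T -> V) (test : seq bool -> T -> bool) k f n e :
  measurable D -> (mu D < +oo)%E -> (forall w, measurable [set t | test w t]) ->
  measurable_fun setT (X : T -> borelV R d) -> lipschitz_sup k f ->
  (forall t, D t -> box B (X t)) ->
  (forall t, D t -> forall i, `|X t 0 i - corner d0 B (path_of test n t) i| <= e) ->
  `|\int[mu]_(t in D) f (X t) -
    \sum_(w : n.-tuple bool)
      f (corner_vec w) * fine (mu (D `&` [set t | path_of test n t = w]))|
  <= k * e * fine (mu D).
Proof.
move=> mD muD mtest mX fk XB Xe.
rewrite -(Rintegral_path_of mtest mD muD n (f \o corner_vec)).
apply: le_dist_Rintegral => //.
- apply: (@bounded_integrable _ _ _ _ _ _ _ _ (`|f 0| + k * B)) => //.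
    apply: measurable_funTS; apply: (measurableT_comp (lipschitz_sup_measurable fk)).
    exact: mX.
  by move=> t /XB; exact: lipschitz_sup_bounded.
- exact: (integrable_path_of mtest mD muD n (f \o corner_vec)).
- by move=> t Dt; apply: fk => i; rewrite mxE; exact: Xe.
Qed.

Lemma box_approximation (mu : {measure set (borelV R d) -> \bar R}) k f n e :
  (mu (box B) < +oo)%E -> lipschitz_sup k f -> (forall i, width d0 B n i <= e) ->
  `|\int[mu]_(x in (box B : set (borelV R d))) f x -
    \sum_(w : n.-tuple bool) f (corner_vec w) *
      fine (mu (box B `&` [set x | path_of (upper_half d0 B) n x = w]))|
  <= k * e * fine (mu (box B)).
Proof.
move=> muB fk we; apply: (@path_approximation _ (borelV R d) mu (box B) (fun x => x)
  (upper_half d0 B) k f n e) => //.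
- exact: measurable_box.
- exact: measurable_upper_half.
- move=> x xB i; have /andP[x1 x2] := @corner_path_of _ _ d0 _ B0 n x i xB.
  rewrite ger0_norm ?subr_ge0// lerBlDl (le_trans x2)// lerD2l; exact: we.
Qed.

Section BranchLimit.
Variable m : seq bool -> R.
Hypotheses (m_ge0 : forall w, 0 <= m w) (m_nil : m [::] = 1)
  (m_cons : forall w, m w = m (false :: w) + m (true :: w)).

Let u (t : measurableTypeR R) i n := corner d0 B (path_of (right_half m) n t) i.

Let u_nd t i : nondecreasing_seq (u t i).
Proof. by apply/nondecreasing_seqP => n; exact: (corner_cons d0 B0 _ _ i).1. Qed.

Let u_le t i n k : u t i (n + k) <= u t i n + width d0 B n i.
Proof.
have mono : nonincreasing_seq (fun n => u t i n + width d0 B n i).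
  apply/nonincreasing_seqP => j.
  have := (corner_cons d0 B0 (right_half m (path_of (right_half m) j t) t)
    (path_of (right_half m) j t) i).2.
  by rewrite !size_path_of.
apply: (@le_trans _ _ (u t i (n + k) + width d0 B (n + k) i)).
  by rewrite lerDl width_ge0.
by apply: mono; exact: leq_addr.
Qed.

Let u_cvg t i : cvgn (u t i).
Proof.
apply: nondecreasing_is_cvgn => //; exists (u t i 0 + width d0 B 0 i) => _ [n _ <-].
by rewrite -[n]add0n; exact: u_le.
Qed.

(** The tree of intervals assigns to [t] an infinite branch, and the corners along the same branch
    of the bisection increase to this point. Its law for uniform [t] is the candidate limit law. *)
Definition branch_limit (t : measurableTypeR R) : V := \row_i limn (u t i).

Lemma measurable_branch_limit :
  measurable_fun setT (branch_limit : measurableTypeR R -> borelV R d).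
Proof.
apply: measurable_borelV => i; apply: (@measurable_fun_cvg _ _ _ _ (fun n t => u t i n)).
  move=> n.
  exact: (measurable_fun_path_of (@measurable_right_half _ m) n ((corner d0 B)^~ i)).
by move=> t _; rewrite mxE; exact: u_cvg.
Qed.

Lemma branch_limit_corner t n i :
  corner d0 B (path_of (right_half m) n t) i <= branch_limit t 0 i <=
  corner d0 B (path_of (right_half m) n t) i + width d0 B n i.
Proof.
rewrite mxE; apply/andP; split; first exact: (nondecreasing_cvgn_le (u_nd t i)).
apply: limr_le => //; exists n => // j /= nj.
by rewrite -(subnKC nj); exact: u_le.
Qed.

Lemma branch_limit_box t : box B (branch_limit t).
Proof. by move=> i; have := branch_limit_corner t 0 i; rewrite /= add0r. Qed.

End BranchLimit.

(** One-sided bounds whose right-hand sides converge along [\oo] are all that is exported, so that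
    the ultrafilter remains internal. At a fixed level of the bisection, both the integral under [P]
    and those under [Q n] are close to finite sums over words, and these sums converge along the
    ultrafilter. *)
Lemma selection (Q : nat -> probability (borelV R d) R) :
  (forall n, Q n (~` box B) = 0%E) ->
  exists2 P : probability (borelV R d) R, P (~` box B) = 0%E &
  forall k f (c : nat -> R) (l : R), lipschitz_sup k f ->
    (forall n, \int[Q n]_(x in (box B : set (borelV R d))) f x <= c n) ->
    c @ \oo --> l -> \int[P]_(x in (box B : set (borelV R d))) f x <= l.
Proof.
move=> QB.
have QB1 n : Q n (box B) = 1%E.
  rewrite -(setCK (box B)) probability_setC; 
    last by apply: measurableC; exact: measurable_box.
  by rewrite QB sube0.
have [F [FU ooF]] := ultraFilterLemma (eventually_filter).
pose cell w : set (borelV R d) :=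
  box B `&` [set x | path_of (upper_half d0 B) (size w) x = w].
have mcell w : measurable (cell w).
  apply: measurableI; first exact: measurable_box.
  by apply: measurable_path_of; exact: measurable_upper_half.
have Mb w k : 0 <= fine (Q k (cell w)) <= 1.
  rewrite fine_ge0//= -lee_fin fineK ?fin_num_measure//.
  exact: probability_le1.
have /choice[m mP] : forall w, exists l : R, 0 <= l <= 1 /\
    (fun k => fine (Q k (cell w))) @ F --> l.
  by move=> w; have [l ? ?] := ultra_cvg_itv FU (Mb w); exists l.
have m_ge0 w : 0 <= m w by have [/andP[]] := mP w.
have m_nil : m [::] = 1.
  apply: (cvg_unique _ (mP [::]).2) => //.
  rewrite (_ : (fun k => _) = fun=> 1); first exact: cvg_cst.
  apply/funext => k; rewrite /cell/= (_ : box B `&` _ = box B) ?QB1//.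
  by apply/seteqP; split => x //= [].
have m_cons w : m w = m (false :: w) + m (true :: w).
  apply: (cvg_unique _ (mP w).2) => //.
  rewrite (_ : (fun k => fine (Q k (cell w))) =
      (fun k => fine (Q k (cell (false :: w)))) \+ (fun k => fine (Q k (cell (true :: w))))).
    exact: cvgD (mP (false :: w)).2 (mP (true :: w)).2.
  apply/funext => k /=; rewrite -fineD ?fin_num_measure//; congr fine.
  exact: (mass_path_of_cons (measurable_upper_half d0 B) (Q k) measurable_box).
have [P PE] := law_exists (uniform_prob (@ltr01 R)) (measurable_branch_limit m).
exists P.
  rewrite PE (_ : _ @^-1` _ = set0) ?measure0//.
  by apply/seteqP; split => t //=; apply; exact: branch_limit_box.
move=> k f c l fk Qc cl.
have k0 : 0 <= k.
  have : `|f 0 - f 0| <= k * 1 by apply: fk => i; rewrite subrr normr0.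
  by rewrite mulr1; exact: le_trans.
rewrite (Rintegral_law (measurable_branch_limit m) PE measurable_box
  (lipschitz_sup_measurable fk) (branch_limit_box _)
  (fun x => lipschitz_sup_bounded fk)).
apply/ler_addgt0Pr => e e0.
(* Two discretisation errors of size [k * e'] occur, one for [P] and one for [Q j]; the added 1
   covers [k = 0]. *)
pose e' := e / (2 * (k + 1)).
have k1 : 0 < 2 * (k + 1) by rewrite mulr_gt0// ltr_wpDl.
have e'0 : 0 < e' by exact: divr_gt0.
have [n ne] := width_small d0 B0 e'0.
have ke : k * e' + k * e' <= e.
  by rewrite -mulr2n -mulr_natl mulrA /e' mulrA ler_pdivrMr// mulrC ler_pM2l//; lra.
pose S (M : seq bool -> R) := \sum_(w : n.-tuple bool) f (corner_vec w) * M w.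
have PS : \int[uniform_prob (@ltr01 R)]_t f (branch_limit m t) <= S m + k * e'.
  have Xe t i : `|branch_limit m t 0 i -
      corner d0 B (path_of (right_half m) n t) i| <= e'.
    have /andP[b1 b2] := branch_limit_corner m t n i.
    by rewrite ger0_norm ?subr_ge0// lerBlDl (le_trans b2)// lerD2l ne.
  have := @path_approximation _ _ (uniform_prob (@ltr01 R)) setT (branch_limit m)
    (right_half m) k f n e' measurableT
    (le_lt_trans (probability_le1 _ measurableT) (ltry 1))
    (@measurable_right_half _ m) (measurable_branch_limit m) fk
    (fun t _ => branch_limit_box m t) (fun t _ => Xe t).
  have -> : fine (uniform_prob (@ltr01 R) setT) = 1 by rewrite probability_setT.
  rewrite mulr1 ler_norml lerBlDl => /andP[_].
  rewrite (eq_bigr (fun w : n.-tuple bool => f (corner_vec w) * m w))//.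
  move=> w _; rewrite setTI; congr (_ * _); rewrite -[RHS]/(fine (m w)%:E); congr fine.
  have mw := measurable_path_of (@measurable_right_half _ m) n w.
  apply: (etrans (uniform_prob01E mw)).
  by apply: lebesgue_path_right_half => //; rewrite size_tuple.
apply: (le_trans PS); rewrite (le_trans _ (_ : l + k * e' + k * e' <= _))//.
  (* Finitely many words of length [n] occur, so the sums converge along [F]; [c] does too because
     [F] refines the eventual filter. *)
  rewrite lerD2r; apply: (@ler_cvg_to _ F _ _ (fun j => S (fun w => fine (Q j (cell w))))
     (fun j => c j + k * e')).
  - apply: cvg_big => [|w _]; [exact: add_continuous|]; apply: cvgM; [exact: cvg_cst|exact: (mP _).2].
  - apply: cvgD; last exact: cvg_cst.
    by apply: cvg_trans cl => A /ooF.
  apply: nearW => j.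
  have := box_approximation (le_lt_trans (probability_le1 (Q j) measurable_box) (ltry 1))
    fk ne.
  have -> : fine (Q j (box B)) = 1 by rewrite QB1.
  rewrite mulr1 ler_norml => /andP[+ _].
  rewrite lerBrDr addrC lerBlDr => /le_trans h.
  rewrite (_ : S _ = \sum_(w : n.-tuple bool) f (corner_vec w) *
      fine (Q j (box B `&` [set x | path_of (upper_half d0 B) n x = w]))).
    by apply: h; rewrite lerD2r.
  by apply: eq_bigr => w _; rewrite /cell size_tuple.
by rewrite -addrA lerD2l.
Qed.

End Selection.

(** * Weighted maxima, support functions and reference norms *)

Section WeightedMax.
Context {R : realType} {d : nat}.
Notation V := 'rV[R]_d.
Implicit Types x y a b : V.

(** The integrand of [max_zonoid], with the weights first so that [wmax x] is a function of the
    spectral variable. The base value 0 makes it nonnegative even off the orthant, whence the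
    condition [0 <= t] in [wmax_leP]. *)
Definition wmax (x a : V) : R := \big[Num.max/0]_(i < d) (a 0 i * x 0 i).

Lemma wmax_leP x a t : 0 <= t -> reflect (forall i, a 0 i * x 0 i <= t) (wmax x a <= t).
Proof.
move=> t0; apply: (iffP (bigmax_leP _ _ _ _)) => [[_ h] i|h]; first exact: h.
by split.
Qed.

Lemma wmax_ge0 x a : 0 <= wmax x a.
Proof. exact: bigmax_ge_id. Qed.

Lemma wmax_ge x a i : a 0 i * x 0 i <= wmax x a.
Proof. exact: le_bigmax. Qed.

Lemma wmaxZr x a t : 0 <= t -> wmax x (t *: a) = t * wmax x a.
Proof.
move=> t0; apply/eqP; rewrite eq_le; apply/andP; split.
  apply/wmax_leP => [|i]; first by rewrite mulr_ge0// wmax_ge0.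
  by rewrite mxE -mulrA ler_wpM2l// wmax_ge.
have [->|tn0] := eqVneq t 0; first by rewrite mul0r wmax_ge0.
have tp : 0 < t by rewrite lt_neqAle eq_sym tn0.
rewrite mulrC -ler_pdivlMr//; apply/wmax_leP => [|i].
  by rewrite divr_ge0// wmax_ge0.
by rewrite ler_pdivlMr// mulrC mulrA; have := wmax_ge x (t *: a) i; rewrite mxE.
Qed.

Lemma lipschitz_wmax x : (0 < d)%N -> lipschitz_sup (\sum_i `|x 0 i|) (wmax x).
Proof.
move=> d0; suff h a b e : (forall i, `|a 0 i - b 0 i| <= e) ->
    wmax x a <= wmax x b + (\sum_i `|x 0 i|) * e.
  move=> a b e ab; rewrite ler_norml; apply/andP; split.
    by rewrite lerBrDr addrC lerBlDr h// => i; rewrite distrC.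
  by rewrite lerBlDl h.
move=> ab; have e0 : 0 <= e by rewrite (le_trans _ (ab (Ordinal d0))).
apply/wmax_leP => [|i]; first by rewrite addr_ge0 ?wmax_ge0// mulr_ge0// sumr_ge0.
rewrite -(subrK (b 0 i) (a 0 i)) mulrDl addrC lerD ?wmax_ge//.
rewrite (le_trans (ler_norm _))// normrM mulrC ler_pM//.
by rewrite (bigD1 i)//= lerDl sumr_ge0.
Qed.

End WeightedMax.

(** * Support functions of sets between the simplex and the cube *)

Section Support.
Context {R : realType} {d : nat}.
Notation V := 'rV[R]_d.
Variable K : set V.
Hypotheses (K0 : K 0) (Ke : forall i, K (delta_mx 0 i))
  (Kcube : K `<=` @unit_cube R d).
Implicit Types x y u v : V.

Let pairing y x := \sum_(i < d) y 0 i * x 0 i.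

Let pairing_le y x : K y -> pairing y x <= \sum_i `|x 0 i|.
Proof.
move=> /Kcube yc; apply: ler_sum => i _; have /andP[y0 y1] := yc i.
by rewrite (le_trans (ler_norm _))// normrM ger0_norm// ler_piMl.
Qed.

Let pairing_sup x : has_sup [set pairing y x | y in K].
Proof.
split; first by exists (pairing 0 x), 0.
by exists (\sum_i `|x 0 i|) => _ [y Ky <-]; exact: pairing_le.
Qed.

Lemma support_fun_ub x y : K y -> pairing y x <= support_fun K x.
Proof. by move=> Ky; apply: (ub_le_sup (pairing_sup x).2); exists y. Qed.

Lemma support_fun_le x t : (forall y, K y -> pairing y x <= t) -> support_fun K x <= t.
Proof.
move=> h; apply: ge_sup; first exact: (pairing_sup x).1.
by move=> _ [y Ky <-]; exact: h.
Qed.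

Lemma support_fun_ge_coord x i : x 0 i <= support_fun K x.
Proof.
apply: le_trans (support_fun_ub x (Ke i)); rewrite /pairing (bigD1 i)//= mxE !eqxx mul1r.
rewrite big1 ?addr0// => j ji; rewrite mxE eqxx/= (negbTE ji) mul0r//.
Qed.

Lemma support_fun_ge0 x : 0 <= support_fun K x.
Proof.
apply: le_trans (support_fun_ub x K0).
by rewrite /pairing big1// => i _; rewrite mxE mul0r.
Qed.

Lemma support_fun_delta t i : 0 <= t -> support_fun K (t *: delta_mx 0 i) = t.
Proof.
move=> t0; apply/eqP; rewrite eq_le; apply/andP; split; last first.
  by have := support_fun_ge_coord (t *: delta_mx 0 i) i; rewrite !mxE !eqxx mulr1.
apply: support_fun_le => y /Kcube yc; rewrite /pairing (bigD1 i)//= !mxE !eqxx mulr1.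
rewrite big1 ?addr0; last first.
  by move=> j ji; rewrite !mxE eqxx/= (negbTE ji) mulr0 mulr0.
by have /andP[? ?] := yc i; rewrite ler_piMl.
Qed.

Lemma support_funZ t x : 0 <= t -> support_fun K (t *: x) = t * support_fun K x.
Proof.
have pZ s y z : pairing y (s *: z) = s * pairing y z.
  by rewrite /pairing mulr_sumr; apply: eq_bigr => i _; rewrite mxE mulrCA.
have le s z : 0 <= s -> support_fun K (s *: z) <= s * support_fun K z.
  move=> s0; apply: support_fun_le => y Ky.
  by rewrite pZ ler_wpM2l//; exact: support_fun_ub.
move=> t0; apply/eqP; rewrite eq_le le//=.
have [->|tn0] := eqVneq t 0; first by rewrite mul0r support_fun_ge0.
have tp : 0 < t by rewrite lt_neqAle eq_sym tn0.
rewrite -ler_pdivlMl// -[x in leLHS](scalerK (lt0r_neq0 tp)).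
by apply: le; rewrite invr_ge0.
Qed.

(** Points of [K] have coordinates at most 1, so a pairing grows by no more than the total increase
    of the coordinates. *)
Lemma support_fun_increment x y : (forall i, y 0 i <= x 0 i) ->
  support_fun K x <= support_fun K y + \sum_i (x 0 i - y 0 i).
Proof.
move=> yx; apply: support_fun_le => z Kz.
have -> : pairing z x = pairing z y + \sum_i z 0 i * (x 0 i - y 0 i).
  by rewrite /pairing -big_split/=; apply: eq_bigr => i _; rewrite mulrBr addrC subrK.
apply: lerD; first exact: support_fun_ub.
apply: ler_sum => i _; have /andP[z0 z1] := Kcube Kz i.
by rewrite ler_piMl// subr_ge0.
Qed.

Definition neg_ln (u : V) : V := \row_i - ln (u 0 i).

Lemma copula_candidate_pos u : (forall i, 0 < u 0 i) ->
  copula_candidate K u = expR (- support_fun K (neg_ln u)).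
Proof.
move=> u0; rewrite /copula_candidate asboolF// => -[i ui].
by have := u0 i; rewrite ui ltxx.
Qed.

Lemma copula_candidate_le_coord u i : (forall i, 0 < u 0 i) ->
  copula_candidate K u <= u 0 i.
Proof.
move=> u0; rewrite copula_candidate_pos// -[leRHS]lnK ?posrE//.
rewrite ler_expR lerNl (le_trans _ (support_fun_ge_coord _ i))// mxE lexx//.
Qed.

Lemma one_sub_prod_le (r : 'I_d -> R) : (forall i, 0 <= r i <= 1) ->
  1 - \prod_i r i <= \sum_i (1 - r i).
Proof.
move=> r01; have pr01 s : 0 <= \prod_(i <- s) r i <= 1.
  elim/big_rec: _ => [|i x _ /andP[x0 x1]]; first by rewrite ler01 lexx.
  by have /andP[r0 r1] := r01 i; rewrite mulr_ge0//= mulr_ile1.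
elim: (index_enum _) => [|i s ih]; first by rewrite !big_nil subrr.
rewrite !big_cons; have /andP[r0 r1] := r01 i; have /andP[p0 p1] := pr01 s.
have : 0 <= (1 - r i) * (1 - \prod_(j <- s) r j) by rewrite mulr_ge0// subr_ge0.
by move: ih; nra.
Qed.

(** The growth bound on [h] gives [C u >= C v * prod (u_i / v_i)]. Hence [C v - C u] is at most the
    sum of [C v * (1 - u_i / v_i)], and [C v <= v_i] turns each term into at most [v_i - u_i]. *)
Lemma copula_candidate_increment u v : (forall i, 0 < u 0 i <= v 0 i) ->
  (forall i, v 0 i <= 1) ->
  copula_candidate K v <= copula_candidate K u + \sum_i (v 0 i - u 0 i).
Proof.
move=> uv v1.
have u0 i : 0 < u 0 i by have /andP[] := uv i.
have v0 i : 0 < v 0 i by have /andP[? ?] := uv i; exact: lt_le_trans (u0 i) _.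
have Cv0 : 0 <= copula_candidate K v by rewrite copula_candidate_pos// expR_ge0.
have r01 i : 0 <= u 0 i / v 0 i <= 1.
  by have /andP[? ?] := uv i; rewrite divr_ge0 ?(ltW (u0 i)) ?(ltW (v0 i))//= ler_pdivrMr// mul1r.
have Cu : copula_candidate K v * \prod_i (u 0 i / v 0 i) <= copula_candidate K u.
  rewrite !copula_candidate_pos//.
  have -> : \prod_i (u 0 i / v 0 i) = expR (- \sum_i (neg_ln u 0 i - neg_ln v 0 i)).
    rewrite -sumrN expR_sum; apply: eq_bigr => i _; rewrite !mxE.
    by rewrite opprB opprK addrC -ln_div ?posrE// lnK ?posrE ?divr_gt0.
  rewrite -expRD ler_expR -opprD lerN2; apply: support_fun_increment => i.
  by rewrite !mxE lerN2 ler_ln ?posrE//; have /andP[] := uv i.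
have := one_sub_prod_le r01.
move=> /(ler_wpM2l Cv0); rewrite mulrBr mulr1 lerBlDr => /le_trans; apply.
rewrite addrC lerD// mulr_sumr; apply: ler_sum => i _.
have vi0 : v 0 i != 0 by rewrite gt_eqF.
rewrite (_ : v 0 i - u 0 i = v 0 i * (1 - u 0 i / v 0 i)).
  by rewrite ler_wpM2r ?copula_candidate_le_coord// subr_ge0; have /andP[] := r01 i.
by rewrite mulrBr mulr1 mulrCA divff// mulr1.
Qed.

End Support.

(** * Norms given by their axioms, and comparison with the sup norm *)

Section ReferenceNorm.
Context {R : realType} {d : nat}.
Hypothesis d0 : (0 < d)%N.
Notation V := 'rV[R]_d.
Variable N : V -> R.
Hypothesis N_norm : is_norm N.

Let N_eq0 x : N x = 0 -> x = 0. Proof. by case: N_norm => h _ _; exact: h. Qed.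

Lemma ref_normZ a x : N (a *: x) = `|a| * N x. Proof. by case: N_norm. Qed.

Lemma ref_normD x y : N (x + y) <= N x + N y. Proof. by case: N_norm. Qed.

Lemma ref_norm0 : N 0 = 0.
Proof. by rewrite -[0 in LHS](scale0r 0) ref_normZ normr0 mul0r. Qed.

Lemma ref_norm_ge0 x : 0 <= N x.
Proof.
have := ref_normD x (- x); rewrite subrr ref_norm0 -scaleN1r ref_normZ normrN1 mul1r.
by rewrite -mulr2n pmulrn_lge0.
Qed.

Lemma ref_norm_gt0 x : x != 0 -> 0 < N x.
Proof.
move=> x0; rewrite lt_neqAle ref_norm_ge0 andbT; apply: contra x0 => /eqP/esym/N_eq0 ->//.
Qed.

Definition norm_sum : R := \sum_i N (delta_mx 0 i).

Lemma ref_norm_le_sum x : N x <= \sum_i `|x 0 i| * N (delta_mx 0 i).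
Proof.
rewrite [x in leLHS]row_sum_delta; elim: (index_enum _) => [|i s ih].
  by rewrite !big_nil ref_norm0.
by rewrite !big_cons (le_trans (ref_normD _ _))// ref_normZ lerD.
Qed.

Lemma lipschitz_ref_norm : lipschitz_sup norm_sum N.
Proof.
suff h (x y : V) e : (forall i, `|x 0 i - y 0 i| <= e) -> N x <= N y + norm_sum * e.
  move=> a b e ab; rewrite ler_norml; apply/andP; split.
    by rewrite lerBrDr addrC lerBlDr h// => i; rewrite distrC.
  by rewrite lerBlDl h.
move=> xy; rewrite -(subrK y x) addrC (le_trans (ref_normD _ _))// lerD2l.
rewrite (le_trans (ref_norm_le_sum _))// /norm_sum mulr_suml.
apply: ler_sum => i _; rewrite !mxE mulrC ler_wpM2l ?ref_norm_ge0//; exact: xy.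
Qed.

(** [N] is continuous by its Lipschitz bound, so it attains a positive minimum on the compact unit
    sphere of the sup norm, which is nonempty since [d > 0]. *)
Lemma ref_norm_lower : exists2 c : R, 0 < c & forall (x : V) i, c * `|x 0 i| <= N x.
Proof.
pose S : set V := [set x | `|x| = 1].
have cS : compact S.
  apply: bounded_closed_compact.
    by exists 1; split => // M M1 x /= ->; exact: ltW.
  have -> : S = (fun x : V => `|x|) @^-1` [set 1] by [].
  by apply: closed_comp => [x _|]; [exact: norm_continuous|exact: closed_eq].
have S0 : S !=set0.
  pose w : V := delta_mx 0 (Ordinal d0).
  have w0 : w != 0.
    apply/eqP => /matrixP /(_ 0 (Ordinal d0)); rewrite !mxE !eqxx /=.
    by move/eqP; rewrite oner_eq0.
  by exists (`|w|^-1 *: w); rewrite /S/= normrZ normfV normr_id mulVf// normr_eq0.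
have cN : {within S, continuous N}.
  by apply: continuous_subspaceT; exact: lipschitz_sup_continuous lipschitz_ref_norm.
have [z /set_mem Sz zmin] := compact_EVT_min S0 cS cN.
have z0 : z != 0 by rewrite -normr_eq0 Sz oner_eq0.
exists (N z) => [|x i]; first exact: ref_norm_gt0.
have [->|x0] := eqVneq x 0; first by rewrite mxE normr0 mulr0 ref_norm_ge0.
have nx0 : 0 < `|x| by rewrite normr_gt0.
apply: (@le_trans _ _ (N z * `|x|)).
  rewrite ler_wpM2l ?ref_norm_ge0// [leRHS]/Num.norm/= mx_normrE.
  exact: (le_bigmax _ (fun ij : 'I_1 * 'I_d => `|x ij.1 ij.2|) (0, i)).
rewrite -ler_pdivlMr//; have -> : N x / `|x| = N (`|x|^-1 *: x).
  by rewrite ref_normZ normfV normr_id mulrC.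
by apply: zmin; rewrite inE /S/= normrZ normfV normr_id mulVf// gt_eqF.
Qed.

End ReferenceNorm.

(** * From max-zonoids to copulas *)

Section LowerSets.
Context {R : realType} {d : nat}.
Hypothesis d0 : (0 < d)%N.
Variable B : R.
Hypothesis B0 : 0 <= B.
Notation V := 'rV[R]_d.

Definition lower_set (u : V) : set (borelV R d) := [set y | forall i, (y : V) 0 i <= u 0 i].

Lemma measurable_lower_set u : measurable (lower_set u).
Proof.
rewrite (_ : lower_set u = \bigcap_(i in [set: 'I_d]) [set y : borelV R d | (y : V) 0 i <= u 0 i]).
  apply: fin_bigcap_measurable => // i _; rewrite -[X in measurable X]setTI.
  by apply: measurable_fun_ler => //; exact: measurable_coord.
by apply/seteqP; split => x xB i; [move=> _|]; exact: xB.
Qed.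

(** The [wmax] term is the largest positive part of [y_i - u_i]; the value falls linearly from 1 to
    0 as this excess goes from 0 to [e]. *)
Definition ramp (u : V) (e : R) (y : V) : R :=
  Num.max 0 (1 - e^-1 * wmax (const_mx 1) (y - u)).

Lemma lipschitz_ramp u e : 0 < e -> lipschitz_sup (e^-1 * d%:R) (ramp u e).
Proof.
move=> e0 x y a xy.
have max_le (s t b : R) : s <= t + b -> 0 <= b -> Num.max 0 s <= Num.max 0 t + b.
  move=> st b0; rewrite ge_max addr_ge0 ?le_max ?lexx//=.
  by rewrite (le_trans st)// lerD2r le_max lexx orbT.
suff h (p q : V) : (forall i, `|p 0 i - q 0 i| <= a) ->
    ramp u e p <= ramp u e q + e^-1 * d%:R * a.
  rewrite ler_norml; apply/andP; split.
    by rewrite lerBrDr addrC lerBlDr h// => i; rewrite distrC.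
  by rewrite lerBlDl h.
move=> pq; have a0 : 0 <= a by rewrite (le_trans _ (pq (Ordinal d0))).
apply: max_le; last by rewrite mulr_ge0// mulr_ge0// invr_ge0 ltW.
have := @lipschitz_wmax R d (const_mx 1) d0 (p - u) (q - u) a.
under eq_bigr do rewrite mxE normr1.
rewrite big_const_ord iter_addr addr0 => h.
have {h} : wmax (const_mx 1) (q - u) <= wmax (const_mx 1) (p - u) + d%:R * a.
  have /h : forall i, `|(p - u) 0 i - (q - u) 0 i| <= a.
    by move=> i; rewrite !mxE opprB addrA subrK.
  by rewrite ler_norml lerBrDr => /andP[]; rewrite addrC lerBlDr mulr_natl.
have c0 : 0 <= e^-1 by rewrite invr_ge0 ltW.
by move=> /(ler_wpM2l c0); rewrite mulrDr mulrA; lra.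
Qed.

Lemma ramp_bounds (u : V) e y : 0 < e -> 0 <= ramp u e y <= 1.
Proof.
move=> e0; rewrite /ramp le_max lexx/= ge_max ler01/= gerBl mulr_ge0 ?wmax_ge0//.
by rewrite invr_ge0 ltW.
Qed.

Lemma ramp1 (u : V) e y : lower_set u y -> ramp u e y = 1.
Proof.
move=> yu; rewrite /ramp (_ : wmax _ _ = 0) ?mulr0 ?subr0 ?max_r//.
apply/eqP; rewrite eq_le wmax_ge0 andbT; apply/wmax_leP => // i.
by rewrite !mxE mulr1 subr_le0; exact: yu.
Qed.

Lemma ramp_supp (u : V) e y : 0 < e -> ramp u e y != 0 -> forall i, y 0 i < u 0 i + e.
Proof.
move=> e0 h i; rewrite ltNge; apply: contra h => uy; apply/eqP/max_l.
rewrite subr_le0 mulrC ler_pdivlMr// mul1r.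
have := wmax_ge (const_mx 1) (y - u) i; rewrite !mxE mulr1; apply: le_trans.
by rewrite lerBrDl.
Qed.

(** The vector [v] is left free because it is [u + e] for one inequality and has to be truncated at
    1 for the other. *)
Lemma Rintegral_ramp (Q : probability (borelV R d) R) (u v : V) (e : R) : 0 < e ->
  (forall y : V, box B y -> (forall i, y 0 i < u 0 i + e) -> lower_set v y) ->
  fine (Q (box B `&` lower_set u)) <=
    \int[Q]_(y in (box B : set (borelV R d))) ramp u e y <=
  fine (Q (box B `&` lower_set v)).
Proof.
move=> e0 uv; have mB := @measurable_box R d B.
have QB : (Q (box B) < +oo)%E 
  by exact: le_lt_trans (probability_le1 Q mB) (ltry 1).
have ri : Q.-integrable (box B) (EFin \o ramp u e).
  apply: (@bounded_integrable _ _ _ _ _ mB QB _ 1).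
    by apply: measurable_funTS; exact: lipschitz_sup_measurable (lipschitz_ramp u e0).
  by move=> y _; have /andP[r0 r1] := ramp_bounds u y e0; rewrite ger0_norm.
have li w : Q.-integrable (box B) (EFin \o \1_(lower_set w)).
  apply: (@bounded_integrable _ _ _ _ _ mB QB _ 1).
    by apply: measurable_indic; exact: measurable_lower_set.
  by move=> y _; rewrite indicE; case: (_ \in _); rewrite ?normr1 ?normr0.
have lE w : fine (Q (box B `&` lower_set w)) =
    \int[Q]_(y in (box B : set (borelV R d))) \1_(lower_set w) y.
  by rewrite /Rintegral integral_indic 1?setIC//; exact: measurable_lower_set.
rewrite !lE; apply/andP; split; apply: le_Rintegral => // y yB; rewrite indicE.
  have [/set_mem /ramp1 ->//|_] := boolP (_ \in _).
  by have /andP[] := ramp_bounds u y e0.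
have [->|/(ramp_supp e0) r0] := eqVneq (ramp u e y) 0; first by rewrite ler0n.
by rewrite mem_set; [have /andP[] := ramp_bounds u y e0|exact: uv].
Qed.

End LowerSets.

(** * Laws attached to finite families of atoms *)

Section FiniteFamilies.
Context {R : realType} {d : nat}.
Notation V := 'rV[R]_d.

Let uniform := uniform_prob (@ltr01 R).

Let uniform_prob01_ray (s : R) : 0 < s -> s <= 1 ->
  lebesgue_measure (`[0%R, 1%R[%classic `&` [set v | v <= s]) = s%:E.
Proof.
move=> s0; rewrite le_eqVlt => /predU1P[->|s1].
  rewrite (_ : _ `&` _ = `[0%R, 1%R[%classic).
    by rewrite lebesgue_measure_itv/= lte_fin ltr01 sube0.
  apply/seteqP; split => v /=; rewrite in_itv/=; first by case.
  by move=> /andP[-> v1]; split=> //; exact: ltW.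
rewrite (_ : _ `&` _ = `[0%R, s]%classic).
  by rewrite lebesgue_measure_itv/= lte_fin s0 sube0.
apply/seteqP; split => v /=; rewrite !in_itv/=; first by case=> /andP[-> _] ->.
by move=> /andP[-> vs]; rewrite (le_lt_trans vs s1).
Qed.

(** For uniform [v], the power [v^(1/b)] has distribution function [u^b]. The value at [b = 0] is
    the limit for [0 <= v < 1]; the minimum keeps the result in [[0, 1]] for every real [v]. *)
Let atom_coord (b : R) (v : R) : R := if b == 0 then 0 else Num.min 1 (v `^ b^-1).

Let atom_coord_bounds b v : 0 <= atom_coord b v <= 1.
Proof.
rewrite /atom_coord; case: ifP => _; first by rewrite lexx ler01.
by rewrite le_min ler01 powR_ge0/= ge_min lexx.
Qed.

Let measurable_atom_coord b :
  measurable_fun setT (atom_coord b : measurableTypeR R -> R).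
Proof.
rewrite /atom_coord; case: eqP => _ //.
by apply: measurable_minr => //; exact: measurable_powR.
Qed.

Let atom_coord_le (b v u : R) : 0 <= b -> 0 <= v < 1 -> 0 < u <= 1 ->
  (atom_coord b v <= u) = (v <= expR (- (b * - ln u))).
Proof.
move=> b0 /andP[v0 v1] /andP[u0 u1]; rewrite /atom_coord.
case: eqVneq => [->|bn0].
  by rewrite (ltW u0) mul0r oppr0 expR0 (ltW v1).
have bp : 0 < b by rewrite lt_neqAle eq_sym bn0.
have -> : expR (- (b * - ln u)) = u `^ b by rewrite /powR gt_eqF// mulrN opprK.
rewrite min_r; last first.
  have p1 : (1 : R) `^ b^-1 = 1 by rewrite powR1.
  by rewrite -[leRHS]p1 ge0_ler_powR ?invr_ge0// ?nnegrE// ltW.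
apply/idP/idP => h.
  rewrite -[v]powRr1// -(mulVf bn0) powRrM.
  by rewrite ge0_ler_powR// ?nnegrE ?powR_ge0// ltW.
rewrite -[u]powRr1 ?(ltW u0)// -(divff bn0) powRrM.
by rewrite ge0_ler_powR ?invr_ge0// ?nnegrE ?powR_ge0.
Qed.

(** Each atom [b] brings one uniform variable, independent of the previous ones and shared by all
    coordinates. Taking coordinatewise maxima multiplies the distribution function by the
    probability that [v <= u_i^(b_i)] for all [i], which is [exp (- wmax (neg_ln u) b)]. The empty
    family is the point mass at 0. *)
Lemma finite_family_law (bs : seq V) : (forall b, b \in bs -> orthant b) ->
  exists2 Q : probability (borelV R d) R, Q (~` box 1) = 0%E &
  forall u : V, (forall i, 0 < u 0 i <= 1) ->
    Q (lower_set u) = (expR (- \sum_(b <- bs) wmax (neg_ln u) b))%:E.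
Proof.
elim: bs => [_|b bs ih bsO].
  have [Q QE] := law_exists uniform (@measurable_cst _ _ _ (borelV R d) setT (0 : V)).
  exists Q.
    rewrite QE (_ : _ @^-1` _ = set0) ?measure0//; apply/seteqP; split => t //=.
    by apply => i; rewrite mxE lexx ler01.
  move=> u u01; rewrite big_nil oppr0 expR0 QE (_ : _ @^-1` _ = setT) ?probability_setT//.
  by apply/seteqP; split => t //= _ i; rewrite mxE ltW//; have /andP[] := u01 i.
have [|Q QB QE] := ih; first by move=> c cbs; apply: bsO; rewrite inE cbs orbT.
have bO : orthant b by apply: bsO; rewrite inE eqxx.
pose T := (borelV R d * measurableTypeR R)%type.
pose X (t : T) : V := \row_i Num.max ((t.1 : V) 0 i) (atom_coord (b 0 i) t.2).
have mX : measurable_fun setT (X : T -> borelV R d).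
  apply: measurable_borelV => i; under eq_fun do rewrite mxE.
  apply: measurable_maxr.
    exact: (measurableT_comp (measurable_coord i) measurable_fst).
  exact: (measurableT_comp (measurable_atom_coord _) measurable_snd).
have [P PE] := law_exists (Q \x uniform)%E mX.
exists P.
  rewrite PE; apply/eqP; rewrite eq_le measure_ge0 andbT.
  apply: (@le_trans _ _ ((Q \x uniform)%E ((~` box 1) `*` setT))); last first.
    rewrite product_measure1E//; last by apply: measurableC; exact: measurable_box.
    by rewrite [X in (X * _)%E](_ : _ = 0%E) ?mul0e//; exact: QB.
  apply: le_measure; rewrite ?inE.
  - rewrite -[X in measurable X]setTI; apply: mX => //.
    by apply: measurableC; exact: measurable_box.
  - by apply: measurableX => //; apply: measurableC; exact: measurable_box.
  move=> t /= nX; split => //; apply: contra_not nX => tB i; rewrite mxE.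
  have /andP[? ?] := tB i; have /andP[? ?] := atom_coord_bounds (b 0 i) t.2.
  by apply/andP; split; [rewrite le_max; apply/orP; left|rewrite ge_max; apply/andP].
move=> u u01; rewrite PE big_cons opprD expRD EFinM.
pose E : set (measurableTypeR R) := [set v | forall i, atom_coord (b 0 i) v <= u 0 i].
rewrite (_ : X @^-1` _ = lower_set u `*` E); last first.
  apply/seteqP; split => [t /= h|t /= [h1 h2] i].
    by split => i; have := h i; rewrite mxE ge_max => /andP[].
  by rewrite mxE ge_max h2 andbT; exact: h1.
have mE : measurable E.
  rewrite (_ : E = \bigcap_(i in [set: 'I_d]) [set v | atom_coord (b 0 i) v <= u 0 i]).
    apply: fin_bigcap_measurable => // i _; rewrite -[X in measurable X]setTI.
    exact: measurable_fun_ler.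
  by apply/seteqP; split => x xB i; [move=> _|]; exact: xB.
apply: (etrans (product_measure1E _ _ (measurable_lower_set u) mE)).
rewrite muleC; congr (_ * _)%E; last exact: QE.
have [u0 u1] : (forall i, 0 < u 0 i) /\ (forall i, u 0 i <= 1).
  by split=> i; have /andP[] := u01 i.
have w1 : expR (- wmax (neg_ln u) b) <= 1 by rewrite expR_le1 oppr_le0 wmax_ge0.
rewrite -(uniform_prob01_ray (expR_gt0 _) w1).
apply: (etrans (uniform_prob01E mE)); apply/esym.
rewrite (_ : `[0%R, 1%R[ `&` E = `[0%R, 1%R[ `&` [set v | v <= expR (- wmax (neg_ln u) b)])//.
apply/seteqP; split=> v /= [v01 vE]; split=> //; move: v01; rewrite in_itv/= => v01.
  (* The point 0 is separated because [v] is about to be written as the exponential of its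
     logarithm. *)
  have [->|vn0] := eqVneq v 0; first exact: expR_ge0.
  have vp : 0 < v by rewrite lt_neqAle eq_sym vn0; case/andP: v01.
  rewrite -[v]lnK ?posrE// ler_expR lerNr; apply/wmax_leP => [|i].
    by rewrite oppr_ge0 ln_le0// ltW//; case/andP: v01.
  have := vE i; rewrite (atom_coord_le (bO i) v01 (u01 i)).
  by rewrite -{1}[v]lnK ?posrE// ler_expR lerNr mxE.
move=> i; rewrite (atom_coord_le (bO i) v01 (u01 i)).
rewrite (le_trans vE)// ler_expR lerN2.
by have := wmax_ge (neg_ln u) b i; rewrite mxE.
Qed.

End FiniteFamilies.

(** * Discretised spectral measures and the limit of their laws *)

Section MaxZonoidToCopula.
Context {R : realType} {d : nat}.
Hypothesis d0 : (0 < d)%N.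
Notation V := 'rV[R]_d.
Variable N : V -> R.
Hypothesis N_norm : is_norm N.

Lemma measurable_orthant : measurable (@orthant R d : set (borelV R d)).
Proof.
rewrite (_ : @orthant R d = \bigcap_(i in [set: 'I_d]) [set x : borelV R d | 0 <= (x : V) 0 i]).
  apply: fin_bigcap_measurable => // i _; rewrite -[X in measurable X]setTI.
  by apply: measurable_fun_ler => //; exact: measurable_coord.
by apply/seteqP; split => x xB i; [move=> _|]; exact: xB.
Qed.

Lemma measurable_ref_sphere : measurable (ref_sphere N : set (borelV R d)).
Proof.
rewrite (_ : ref_sphere N = @orthant R d `&` (N @^-1` [set 1]))//.
apply: measurableI; first exact: measurable_orthant.
rewrite -[X in measurable X]setTI.
by apply: (lipschitz_sup_measurable (lipschitz_ref_norm N_norm)) => //; exact: measurable_set1.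
Qed.

Lemma ref_sphere_box : exists2 B : R, 0 < B & ref_sphere N `<=` box B.
Proof.
have [c c0 cN] := ref_norm_lower d0 N_norm; exists c^-1; first by rewrite invr_gt0.
move=> x [xO xN] i; rewrite xO/= -[leRHS]mul1r ler_pdivlMr// mulrC -xN.
by rewrite (le_trans _ (cN x i))// ler_wpM2l ?(ltW c0)// ler_norm.
Qed.

Lemma lipschitz_sup_integrable (mu : {measure set (borelV R d) -> \bar R}) (B : R) k f :
  0 <= B -> (mu (box B) < +oo)%E -> lipschitz_sup k f ->
  mu.-integrable (box B) (EFin \o f).
Proof.
move=> B0 Bfin fk.
apply: (@bounded_integrable _ _ _ _ _ (@measurable_box R d B) Bfin _ (`|f 0| + k * B)).
  by apply: measurable_funTS; exact: lipschitz_sup_measurable fk.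
by move=> x; exact: lipschitz_sup_bounded.
Qed.

Lemma selection_ge (B : R) (Q : nat -> probability (borelV R d) R)
    (P : probability (borelV R d) R) k f (c : nat -> R) (l : R) : 0 <= B ->
  (forall k f (c : nat -> R) (l : R), lipschitz_sup k f ->
    (forall n, \int[Q n]_(x in (box B : set (borelV R d))) f x <= c n) ->
    c @ \oo --> l -> \int[P]_(x in (box B : set (borelV R d))) f x <= l) ->
  lipschitz_sup k f ->
  (forall n, c n <= \int[Q n]_(x in (box B : set (borelV R d))) f x) ->
  c @ \oo --> l -> l <= \int[P]_(x in (box B : set (borelV R d))) f x.
Proof.
move=> B0 sel fk cQ cl; have mB := @measurable_box R d B.
have opp (mu : probability (borelV R d) R) :
    \int[mu]_(x in (box B : set (borelV R d))) (- 1 * f x) =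
    - 1 * \int[mu]_(x in (box B : set (borelV R d))) f x.
  apply: RintegralZl => //; apply: (lipschitz_sup_integrable B0 _ fk).
  exact: le_lt_trans (probability_le1 mu mB) (ltry 1).
rewrite -lerN2 -mulN1r -opp; apply: (sel k _ (fun n => - c n)).
- move=> x y e xy; rewrite !mulN1r -opprD normrN; exact: fk.
- by move=> n; rewrite opp mulN1r lerN2; exact: cQ.
- exact: cvgN.
Qed.

(** The spectral measure is carried by the sphere, while bisection and limits take place on a box
    containing it. *)
Lemma Rintegral_ref_sphere (sigma : {measure set (borelV R d) -> \bar R}) (B : R) k f :
  ref_sphere N `<=` box B -> 0 <= B -> (sigma setT < +oo)%E ->
  sigma (~` ref_sphere N) = 0%E -> lipschitz_sup k f ->
  \int[sigma]_(x in (ref_sphere N : set (borelV R d))) f x =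
  \int[sigma]_(x in (box B : set (borelV R d))) f x.
Proof.
move=> SB B0 sfin sS fk; have mB := @measurable_box R d B.
have mS := measurable_ref_sphere.
have mBS : measurable (box B `\` ref_sphere N : set (borelV R d)) by exact: measurableD.
have Bfin : (sigma (box B) < +oo)%E.
  by apply: le_lt_trans sfin; apply: le_measure; rewrite ?inE.
have fi := lipschitz_sup_integrable B0 Bfin fk.
rewrite /Rintegral [in RHS](negligible_integral mBS mB fi).
  by rewrite setDD setIidr.
apply/eqP; rewrite eq_le measure_ge0 andbT -sS; apply: le_measure; rewrite ?inE//.
exact: measurableC.
Qed.

Variable K : set V.
Hypotheses (K0 : K 0) (Ke : forall i, K (delta_mx 0 i))
  (Kcube : K `<=` @unit_cube R d).

(* The measure sigma is replaced by the finite family obtained by moving the mass of each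
   cell of a bisection to its corner. *)
Lemma finite_family_approximation : max_zonoid N K -> exists bs : nat -> seq V,
  (forall n b, b \in bs n -> orthant b) /\
  forall x, orthant x ->
    (fun n => \sum_(b <- bs n) wmax x b) @ \oo --> support_fun K x.
Proof.
move=> [sigma [sfin sS _ sE]]; have [B Bp SB] := ref_sphere_box.
have B0 := ltW Bp; have mB := @measurable_box R d B.
have Bfin : (sigma (box B) < +oo)%E.
  by apply: le_lt_trans sfin; apply: le_measure; rewrite ?inE.
pose s := fine (sigma (box B)).
have s0 : 0 <= s by rewrite fine_ge0.
have hE x : orthant x -> support_fun K x =
    \int[sigma]_(a in (box B : set (borelV R d))) wmax x a.
  move=> xO; rewrite -(Rintegral_ref_sphere SB B0 sfin sS (lipschitz_wmax x d0)).
  by rewrite /Rintegral -(sE _ xO).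
have /choice[lev levP] : forall n : nat, exists m, forall i, width d0 B m i <= n.+1%:R^-1.
  by move=> n; apply: width_small => //; rewrite invr_gt0.
pose cell m (w : seq bool) : set (borelV R d) :=
  box B `&` [set x | path_of (upper_half d0 B) m x = w].
(* An atom of mass [m] at [b] contributes [m * wmax x b = wmax x (m *: b)], so the mass is absorbed
   into the vector. *)
pose bs n : seq V := [seq fine (sigma (cell (lev n) w)) *: corner_vec d0 B w |
  w : (lev n).-tuple bool].
have bsE n x : \sum_(b <- bs n) wmax x b =
    \sum_(w : (lev n).-tuple bool)
      wmax x (corner_vec d0 B w) * fine (sigma (cell (lev n) w)).
  rewrite /bs big_map big_enum/=; apply: eq_bigr => w _.
  by rewrite wmaxZr ?fine_ge0// mulrC.
exists bs; split=> [n b /mapP[w _ ->] i|x xO].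
  by rewrite mxE mulr_ge0 ?fine_ge0// mxE; have [] := corner_bounds d0 B0 w i.
pose k := \sum_i `|x 0 i|.
have k0 : 0 <= k by exact: sumr_ge0.
apply/cvgrPdist_le => e e0.
have [m _ mP] : \forall n \near \oo, k * s * n.+1%:R^-1 <= e.
  have : (fun n => k * s * n.+1%:R^-1) @ \oo --> k * s * 0.
    by apply: cvgM; [exact: cvg_cst|exact: cvg_harmonic].
  rewrite mulr0 => /cvgrPdist_le/(_ _ e0); apply: filterS => n /=.
  by rewrite sub0r normrN ger0_norm// !mulr_ge0.
exists m => // n mn /=; rewrite hE// bsE.
apply: le_trans (mP n mn); rewrite mulrAC.
exact: (box_approximation B0 Bfin (lipschitz_wmax x d0) (levP n)).
Qed.

Lemma max_zonoid_is_copula : max_zonoid N K -> is_copula (copula_candidate K).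
Proof.
move=> /finite_family_approximation[bs [bsO bsh]].
have /choice[Q QP] : forall n, exists Q : probability (borelV R d) R,
    Q (~` box 1) = 0%E /\ forall u : V, (forall i, 0 < u 0 i <= 1) ->
    Q (lower_set u) = (expR (- \sum_(b <- bs n) wmax (neg_ln u) b))%:E.
  by move=> n; have [Q ? ?] := finite_family_law (bsO n); exists Q.
have [P PB Psel] := @selection R d d0 1 (@ler01 R) Q (fun n => (QP n).1).
have mB := @measurable_box R d 1.
have mL := @measurable_lower_set R d.
have boxI (Q' : probability (borelV R d) R) (A : set (borelV R d)) : Q' (~` box 1) = 0%E -> measurable A ->
    Q' ((box 1 : set (borelV R d)) `&` A) = Q' A.
  move=> QB mA; apply/eqP; rewrite eq_le; apply/andP; split.
    by apply: le_measure; rewrite ?inE//; exact: measurableI.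
  have mBA : measurable ((box 1 : set (borelV R d)) `&` A) by exact: measurableI.
  have mCB : measurable (~` box 1 : set (borelV R d)) by exact: measurableC.
  apply: (@le_trans _ _ (Q' (((box 1 : set (borelV R d)) `&` A) `|` ~` box 1))).
    apply: le_measure; rewrite ?inE//; first exact: measurableU.
    by move=> y Ay; have [yB|yB] := pselect (box 1 y); [left|right].
  apply: (le_trans (measureU2 _ _ _)) => //.
  by rewrite [X in (_ + X <= _)%E](_ : _ = 0%E) ?adde0//; exact: QB.
have C_cvg (u : V) : (forall i, 0 < u 0 i <= 1) ->
    (fun n => fine (Q n (box 1 `&` lower_set u))) @ \oo --> copula_candidate K u.
  move=> u01; rewrite copula_candidate_pos; last by move=> i; have /andP[] := u01 i.
  rewrite (_ : (fun n => _) = (fun n => expR (- \sum_(b <- bs n) wmax (neg_ln u) b))).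
    apply: continuous_cvg; first exact: continuous_expR.
    apply: cvgN; apply: bsh => i; rewrite mxE oppr_ge0 ln_le0//.
    by have /andP[] := u01 i.
  by apply/funext => n; rewrite boxI ?(QP n).1// (QP n).2.
(* [P (lower_set u)] is at most the integral of the ramp, itself bounded by the limit of
   [Q n (lower_set v)]. Truncation at 1 keeps [v] where this limit is known and loses nothing inside
   the box. *)
have upper (u v : V) e : 0 < e -> (forall i, 0 < v 0 i) ->
    (forall i, v 0 i = Num.min (u 0 i + e) 1) ->
    fine (P (lower_set u)) <= copula_candidate K v.
  move=> e0 v0 vE; have v01 i : 0 < v 0 i <= 1 by rewrite v0/= vE ge_min lexx orbT.
  have uv (y : V) : box 1 y -> (forall i, y 0 i < u 0 i + e) -> lower_set v y.
    by move=> yB yu i; rewrite vE le_min ltW//=; have /andP[] := yB i.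
  rewrite -(boxI P)//; have /andP[+ _] := Rintegral_ramp d0 P e0 uv.
  move=> /le_trans; apply; apply: Psel (lipschitz_ramp d0 u e0) _ (C_cvg _ v01) => n.
  by have /andP[] := Rintegral_ramp d0 (Q n) e0 uv.
have lower (u v : V) e : 0 < e -> (forall i, 0 < u 0 i <= 1) ->
    (forall i, v 0 i = u 0 i + e) ->
    copula_candidate K u <= fine (P (lower_set v)).
  move=> e0 u01 vE.
  have uv (y : V) : box 1 y -> (forall i, y 0 i < u 0 i + e) -> lower_set v y.
    by move=> _ yu i; rewrite vE ltW.
  rewrite -(boxI P)//; have /andP[_] := Rintegral_ramp d0 P e0 uv.
  apply: le_trans.
  apply: (selection_ge ler01 Psel (lipschitz_ramp d0 u e0) _ (C_cvg _ u01)) => n.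
  by have /andP[] := Rintegral_ramp d0 (Q n) e0 uv.
have cand0 (u : V) i : u 0 i = 0 -> copula_candidate K u = 0.
  by move=> ui; rewrite /copula_candidate asboolT//; exists i.
have dR0 : 0 < d%:R :> R by rewrite ltr0n.
have sum_cst (e : R) : \sum_(i < d) e = d%:R * e.
  by rewrite sumr_const card_ord mulr_natl.
have cdf (u : V) : unit_cube u -> P (lower_set u) = (copula_candidate K u)%:E.
  move=> uc; rewrite -[LHS]fineK ?fin_num_measure//; congr EFin.
  have u1 i : u 0 i <= 1 by have /andP[] := uc i.
  have uge0 i : 0 <= u 0 i by have /andP[] := uc i.
  apply/eqP; rewrite eq_le; apply/andP; split; apply/ler_addgt0Pr => e e0.
    pose e' := e / d%:R; have e'0 : 0 < e' by exact: divr_gt0.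
    pose v : V := \row_i Num.min (u 0 i + e') 1.
    have vE i : v 0 i = Num.min (u 0 i + e') 1 by rewrite mxE.
    have v0 i : 0 < v 0 i by rewrite vE lt_min ltr01 andbT ltr_wpDl.
    apply: (le_trans (upper _ _ _ e'0 v0 vE)).
    have [[i ui]|/forallNP un0] := pselect (exists i, u 0 i = 0).
      rewrite (cand0 _ _ ui) add0r (le_trans (copula_candidate_le_coord K0 Ke Kcube i v0))//.
      rewrite vE ui add0r ge_min ler_pdivrMr// ler_peMr ?(ltW e0)// ler1n d0//.
    have u0 i : 0 < u 0 i by rewrite lt_neqAle uge0 andbT eq_sym; apply/eqP/un0.
    have uv i : 0 < u 0 i <= v 0 i.
      by rewrite u0 vE le_min u1 andbT/= lerDl ltW.
    have v1 i : v 0 i <= 1 by rewrite vE ge_min lexx orbT.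
    apply: (le_trans (copula_candidate_increment K0 Ke Kcube uv v1)); rewrite lerD2l.
    rewrite (@le_trans _ _ (\sum_(i < d) e'))//.
      by apply: ler_sum => i _; rewrite lerBlDl vE ge_min lexx.
    by rewrite sum_cst /e' mulrC divfK// gt_eqF.
  have [[i ui]|/forallNP un0] := pselect (exists i, u 0 i = 0).
    by rewrite (cand0 _ _ ui) addr_ge0 ?fine_ge0// ltW.
  have u0 i : 0 < u 0 i by rewrite lt_neqAle uge0 andbT eq_sym; apply/eqP/un0.
  pose a := \big[Num.min/1]_i u 0 i.
  have a0 : 0 < a by apply/lt_bigmin.
  (* The first bound makes the [d] increments add up to at most [e]; the second keeps [u - e']
     positive, [a] being at most every [u_i]. *)
  pose e' := Num.min (e / d%:R) (a / 2).
  have e'0 : 0 < e' by rewrite lt_min !divr_gt0.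
  have e'u i : e' < u 0 i.
    have ai : a <= u 0 i by exact: bigmin_le.
    apply: lt_le_trans ai; rewrite (@le_lt_trans _ _ (a / 2))//.
      by rewrite ge_min lexx orbT.
    by rewrite ltr_pdivrMr// ltr_pMr// ltr1n.
  pose v : V := \row_i (u 0 i - e').
  have v01 i : 0 < v 0 i <= 1.
    by rewrite mxE subr_gt0 e'u/= lerBlDr (le_trans (u1 i))// lerDl ltW.
  have uv i : u 0 i = v 0 i + e' by rewrite mxE subrK.
  have vu i : 0 < v 0 i <= u 0 i by have /andP[-> _] := v01 i; rewrite uv lerDl ltW.
  apply: (le_trans (copula_candidate_increment K0 Ke Kcube vu u1)).
  apply: lerD; first exact: lower uv.
  rewrite (eq_bigr (fun=> e')); last by move=> i _; rewrite uv addrC addKr.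
  by rewrite sum_cst mulrC -ler_pdivlMr// ge_min lexx.
exists _, (borelV R d), P, (fun i x => (x : V) 0 i); split.
- by move=> i; exact: measurable_coord.
- move=> i t; have mi : measurable [set y : borelV R d | (y : V) 0 i <= t].
    rewrite -[X in measurable X]setTI.
    by apply: measurable_fun_ler => //; exact: measurable_coord.
  have [t0|t0] := ltP t 0.
    rewrite min_l// -(boxI P)// (_ : _ `&` _ = set0) ?measure0//.
    apply/seteqP; split => y //= [/(_ i)/andP[y0 _] yt].
    by have := lt_le_trans t0 (le_trans y0 yt); rewrite ltxx.
  set s := Num.min t 1.
  have s0 : 0 <= s by rewrite le_min t0 ler01.
  (* The marginal is the joint distribution function with 1 in the other places; then [neg_ln u] is
     a multiple of [e_i], on which [h] is explicit. *)
  pose u : V := \row_j (if j == i then s else 1).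
  have uc : unit_cube u.
    move=> j; rewrite mxE; case: ifP => _; last by rewrite ler01 lexx.
    by rewrite s0 ge_min lexx orbT.
  rewrite -(boxI P)// (_ : _ `&` _ = box 1 `&` lower_set u); last first.
    apply/seteqP; split => y /= [yB yt]; split => //.
      move=> j; rewrite mxE; have /andP[_ y1] := yB j.
      by case: eqVneq => [->|//]; rewrite le_min yt; have /andP[] := yB i.
    by have := yt i; rewrite mxE eqxx le_min => /andP[].
  rewrite boxI// cdf//; congr EFin.
  have [s0'|sn0] := eqVneq s 0.
    by rewrite (cand0 _ i)// mxE eqxx.
  have sp : 0 < s by rewrite lt_neqAle eq_sym sn0.
  rewrite copula_candidate_pos; last by move=> j; rewrite mxE; case: ifP.
  rewrite (_ : neg_ln u = (- ln s) *: delta_mx 0 i).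
    rewrite support_fun_delta ?opprK ?lnK// oppr_ge0 ln_le0//.
    by rewrite ge_min lexx orbT.
  apply/rowP => j; rewrite !mxE eqxx/=; case: eqP => _; first by rewrite mulr1.
  by rewrite ln1 oppr0 mulr0.
- by move=> u uc; rewrite -cdf.
Qed.

End MaxZonoidToCopula.

(** * From copulas to max-zonoids *)

Section Density.
Context dsp {T : measurableType dsp} {R : realType}.
Local Open Scope ereal_scope.
Import HBNNSimple.

Variables (P : {measure set T -> \bar R}) (g : T -> R).
Hypotheses (mg : measurable_fun setT g) (g0 : (forall t, 0 <= g t)%R)
  (g1 : \int[P]_t (g t)%:E = 1).

Definition with_density (A : set T) : \bar R := \int[P]_(t in A) (g t)%:E.

Let mgE : measurable_fun setT (EFin \o g). Proof. exact/measurable_EFinP. Qed.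

Let with_density0 : with_density set0 = 0. Proof. exact: integral_set0. Qed.

Let with_density_ge0 A : 0 <= with_density A.
Proof. by apply: integral_ge0 => t _; rewrite lee_fin. Qed.

Let with_density_sigma_additive : semi_sigma_additive with_density.
Proof.
move=> F mF tF mUF; rewrite /with_density; apply: cvg_toP.
  apply: ereal_nondecreasing_is_cvgn => m n mn.
  apply: lee_sum_nneg_natr => // k _ _.
  by apply: integral_ge0 => t _; rewrite lee_fin.
rewrite ge0_integral_bigcup//=; first exact: measurable_funTS.
by move=> t _; rewrite lee_fin.
Qed.

HB.instance Definition _ := isMeasure.Build _ _ _ with_density
  with_density0 with_density_ge0 with_density_sigma_additive.

HB.instance Definition _ := @Measure_isProbability.Build _ _ R with_density g1.

(** The formula holds for indicators by definition of [with_density], then for simple functions by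
    linearity, and for [f] by monotone convergence on both sides. *)
Lemma density_exists : exists Q : probability T R,
  forall f : T -> R, measurable_fun setT f ->
    (forall t, 0 <= f t)%R -> \int[Q]_t (f t)%:E = \int[P]_t (f t * g t)%:E.
Proof.
pose Q : probability T R := with_density.
exists Q => f mf f0.
have mfE : measurable_fun setT (EFin \o f) by exact/measurable_EFinP.
pose h := nnsfun_approx measurableT mfE.
have hf t : (EFin \o h n) t @[n --> \oo] --> (f t)%:E.
  by apply: (cvg_nnsfun_approx measurableT mfE) => // x _; rewrite lee_fin.
transitivity (lim (\int[Q]_t (h n t)%:E @[n --> \oo])).
  rewrite -monotone_convergence//=.
  - apply: eq_integral => t _; by apply/esym/cvg_lim => //; exact: (hf t).
  - by move=> n; exact/measurable_EFinP.
  - by move=> n t _; rewrite lee_fin.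
  - by move=> t _ a b ab; rewrite lee_fin; exact/lefP/nd_nnsfun_approx.
transitivity (lim (\int[P]_t (h n t * g t)%:E @[n --> \oo])); last first.
  rewrite -monotone_convergence//=.
  - apply: eq_integral => t _; apply/cvg_lim => //.
    under eq_fun do rewrite EFinM; rewrite EFinM.
    by apply: cvgeZr => //; exact: hf.
  - by move=> n; apply/measurable_EFinP; exact: measurable_funM.
  - by move=> n t _; rewrite lee_fin mulr_ge0.
  - move=> t _ a b ab; rewrite lee_fin ler_wpM2r//; exact/lefP/nd_nnsfun_approx.
suff E n : \int[Q]_t (h n t)%:E = \int[P]_t (h n t * g t)%:E.
  by under eq_fun do rewrite E.
rewrite integral_nnsfun// sintegralE (_ : h n \_ setT = h n); last first.
  by apply/funext => t; rewrite patchE mem_set.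
have hy0 y t : (0 <= y * \1_(h n @^-1` [set y]) t)%R.
  rewrite indicE; have [/set_mem/= <-|_] := boolP (_ \in _); first by rewrite mulr1.
  by rewrite mulr0.
have mh y : measurable (h n @^-1` [set y]) by exact: measurable_sfunP.
transitivity (\int[P]_t (\sum_(y \in range (h n)) (y * \1_(h n @^-1` [set y]) t * g t)%:E)).
  rewrite ge0_integral_fsum//; last 2 first.
  - move=> y; apply/measurable_EFinP; apply: measurable_funM => //.
    by apply: measurable_funM => //; exact: measurable_indic.
  - by move=> y t _; rewrite lee_fin mulr_ge0.
  apply: eq_fsbigr => y /set_mem[t _ yE].
  have y0 : (0 <= y)%R by rewrite -yE.
  transitivity (y%:E * \int[P]_t (\1_(h n @^-1` [set y]) t * g t)%:E); last first.
    rewrite -ge0_integralZl//; last 2 first.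
    - by apply/measurable_EFinP; apply: measurable_funM => //; exact: measurable_indic.
    - by move=> u _; rewrite lee_fin mulr_ge0.
    by apply: eq_integral => u _; rewrite -EFinM mulrA.
  congr (_ * _); rewrite /= /with_density integral_mkcond; apply: eq_integral => u _.
  by rewrite patchE indicE; case: (_ \in _); rewrite ?mul1r ?mul0r.
apply: eq_integral => t _; rewrite fsumEFin// (fimfunE (h n) t); congr EFin.
by rewrite mulr_fsuml.
Qed.

End Density.

(** * Moments computed from tails *)

Section TailIntegrals.
Context dsp {T : measurableType dsp} {R : realType}.
Variable P : probability T R.

Let expectation_tail (Y : T -> R) : measurable_fun setT Y -> (forall t, 0 <= Y t) ->
  (\int[P]_t (Y t)%:E =
   \int[@lebesgue_measure R]_(r in `]0%R, +oo[) P [set t | r < Y t]%R)%E.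
Proof.
move=> mY Y0; pose Y' : {RV P >-> R} := mfun_Sub (mem_set mY).
have := ge0_expectation_ccdf (X := Y') Y0.
rewrite expectation_def => ->.
rewrite -integral_itv_obnd_cbnd; last first.
  by apply: measurable_funTS; exact: ccdf_measurable.
apply: eq_integral => r _.
by rewrite /ccdf /distribution /pushforward set_itvoy.
Qed.

(** Expectations are integrals of tails over []0, +oo[], so positive thresholds suffice. The
    equality is in the extended reals and can be used before any moment is known to be finite. *)
Lemma eq_expectation_tail (Y Z : T -> R) :
  measurable_fun setT Y -> measurable_fun setT Z ->
  (forall t, 0 <= Y t) -> (forall t, 0 <= Z t) ->
  (forall r : R, 0 < r -> P [set t | Y t <= r] = P [set t | Z t <= r]) ->
  (\int[P]_t (Y t)%:E = \int[P]_t (Z t)%:E)%E.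
Proof.
move=> mY mZ Y0 Z0 YZ; rewrite !expectation_tail//; apply: eq_integral => r.
rewrite inE/= in_itv/= andbT => r0.
have C (W : T -> R) : measurable_fun setT W -> P [set t | r < W t] = (1 - P [set t | (W t <= r)%R])%E.
  move=> mW; rewrite -probability_setC.
    by congr (P _); apply/seteqP; split => t /=; rewrite ltNge => /negP.
  rewrite -[X in measurable X]setTI; exact: measurable_fun_ler.
by rewrite !C// YZ.
Qed.

Lemma powR_tail_integral (q : R) : 1 < q ->
  (\int[@lebesgue_measure R]_(r in `[1%R, +oo[) (r `^ (- q))%:E < +oo)%E.
Proof.
move=> q1; pose F (r : R) := (1 - q)^-1 * r `^ (1 - q).
have q10 : 1 - q < 0 by rewrite subr_lt0.
have cpow (a x : R) : 0 < x -> {for x, continuous (fun r => r `^ a)}.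
  move=> x0; apply: differentiable_continuous; apply/derivable1_diffP.
  by apply: derivable_powR; rewrite in_itv/= andbT.
rewrite (@ge0_continuous_FTC2y R (fun r => r `^ (- q)) F 1 0).
- by rewrite add0e -EFinN ltry.
- by move=> x _; exact: powR_ge0.
- apply: continuous_in_subspaceT => x /set_mem/=; rewrite in_itv/= andbT => x1.
  by apply: cpow; rewrite (lt_le_trans _ x1).
- rewrite /F -(mulr0 (1 - q)^-1); apply: cvgM; first exact: cvg_cst.
  apply/cvgrPdist_le => e e0; near=> r.
  have r0 : 0 < r by near: r; exact: nbhs_pinfty_gt.
  (* The threshold solves [r^(1 - q) = e]; the exponent is negative, so larger [r] give smaller
     values. *)
  have re : expR ((1 - q)^-1 * ln e) <= r by near: r; exact: nbhs_pinfty_ge.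
  rewrite sub0r normrN ger0_norm ?powR_ge0//.
  rewrite -[leRHS]lnK ?posrE// /powR gt_eqF// ler_expR.
  rewrite -ler_ndivrMl//.
  rewrite -[leLHS]expRK ler_ln ?posrE ?expR_gt0//.
- move=> x x1; apply: derivableM => //; apply: derivable_powR.
  by rewrite in_itv/= andbT (lt_trans _ x1).
- apply: cvgM; first exact: cvg_cst.
  by apply: cvg_at_right_filter; exact: cpow.
- move=> x; rewrite in_itv/= andbT => x1.
  have x0 : 0 < x by rewrite (lt_trans _ x1).
  rewrite derive1E deriveM//; last first.
    by apply: derivable_powR; rewrite in_itv/= andbT.
  rewrite derive_cst scaler0 addr0 -derive1E powR_derive1 ?in_itv/= ?andbT//.
  rewrite /GRing.scale/= mulrA mulVf ?mul1r ?lt_eqF//.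
  by congr (_ `^ _); rewrite addrAC subrr add0r.
Unshelve. all: by end_near. Qed.

Lemma powR_le_invE (p y r : R) : 0 < p -> 0 <= y -> 0 <= r ->
  (y `^ p <= r) = (y <= r `^ p^-1).
Proof.
move=> p0 y0 r0; have pn0 : p != 0 by rewrite gt_eqF.
apply/idP/idP => h.
  rewrite -[y]powRr1// -(divff pn0) powRrM.
  by rewrite ge0_ler_powR ?invr_ge0 ?nnegrE ?powR_ge0// ltW.
rewrite -[r]powRr1// -(mulVf pn0) powRrM.
by rewrite ge0_ler_powR ?nnegrE ?powR_ge0// ltW.
Qed.

Let measurable_tail (Y : T -> R) : measurable_fun setT Y ->
  measurable_fun setT (fun r : R => P [set t | (r < Y t)%R]).
Proof.
move=> mY; pose Y' : {RV P >-> R} := mfun_Sub (mem_set mY).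
have := ccdf_measurable Y'; congr measurable_fun; apply/funext => r.
by rewrite /ccdf /distribution /pushforward set_itvoy.
Qed.

(** The tail of [Y^p] at [r] is [1 - exp (- r^(-1/p)) <= r^(-1/p)], integrable at infinity because
    [1/p > 1]; on []0, 1[] the trivial bound 1 is enough. *)
Lemma powR_expectation_finite (Y : T -> R) (p : R) :
  measurable_fun setT Y -> (forall t, 0 <= Y t) -> 0 < p < 1 ->
  (forall r : R, 0 < r -> P [set t | Y t <= r] = (expR (- r^-1))%:E) ->
  (\int[P]_t (Y t `^ p)%:E < +oo)%E.
Proof.
move=> mY Y0 /andP[p0 p1] YP.
have mYp : measurable_fun setT (fun t => Y t `^ p).
  exact: (measurableT_comp (@measurable_powR R p) mY).
rewrite expectation_tail//; last by move=> t; exact: powR_ge0.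
have pi0 : 0 < p^-1 by rewrite invr_gt0.
have tail (r : R) : 0 < r -> (P [set t | (r < Y t `^ p)%R] <= (r `^ (- p^-1))%:E)%E.
  move=> r0; pose s := r `^ p^-1.
  have s0 : 0 < s by exact: powR_gt0.
  rewrite (_ : [set t | _] = ~` [set t | Y t <= s]).
    rewrite probability_setC; last first.
      by rewrite -[X in measurable X]setTI; exact: measurable_fun_ler.
    rewrite YP// -EFinB lee_fin powRN -/s lerBlDr -lerBlDl.
    by have := expR_ge1Dx (- s^-1).
  by apply/seteqP; split => t /=; rewrite /s -powR_le_invE ?(ltW r0)// ltNge => /negP.
have q1 : 1 < p^-1 by rewrite invf_gt1.
have -> : `]0%R, +oo[%classic = `]0%R, 1%R[%classic `|` `[1%R, +oo[%classic :> set R.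
  by rewrite -itv_bndbnd_setU ?bnd_simp.
have mt := measurable_tail mYp.
rewrite ge0_integral_setU//=; last 2 first.
- exact: measurable_funTS.
- apply/disj_setPRL => r /=; rewrite !in_itv/= andbT => /le_lt_trans r1 /andP[_ /r1].
  by rewrite ltxx.
apply: lte_add_pinfty.
  apply: (@le_lt_trans _ _ (\int[@lebesgue_measure R]_(r in `]0%R, 1%R[) 1)%E).
    apply: ge0_le_integral => //; first exact: measurable_funTS.
    move=> r _; apply: probability_le1.
    by rewrite -[X in measurable X]setTI; exact: measurable_fun_ltr.
  by rewrite integral_cst//= mul1e lebesgue_measure_itv/= lte_fin ltr01 -EFinB ltry.
apply: le_lt_trans (powR_tail_integral q1).
apply: ge0_le_integral => //.
- exact: measurable_funTS.
- apply/measurable_EFinP/measurable_funTS; exact: measurable_powR.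
- by move=> r /=; rewrite in_itv/= andbT => r1; apply: tail; exact: lt_le_trans r1.
Qed.

End TailIntegrals.

Section PowerBound.
Context {R : realType}.

(** From [m = m^p * exp ((1 - p) * ln m)] and [1 + z <= exp z], used in both directions. The term
    [b^2] bounds [m * ln m] through [ln m < m]; the term 2 bounds [- ln m * m^p <= 1/p], which is
    where [p >= 1/2] enters. *)
Lemma powR_near_id (m b p : R) : 0 <= m <= b -> 2^-1 <= p < 1 ->
  `|m `^ p - m| <= (b ^+ 2 + 2) * (1 - p).
Proof.
move=> /andP[m0 mb] /andP[p2 p1].
have p0 : 0 < p by rewrite (lt_le_trans _ p2)// invr_gt0.
have q0 : 0 < 1 - p by rewrite subr_gt0.
have [->|mn0] := eqVneq m 0.
  by rewrite powR0 ?gt_eqF// subrr normr0 mulr_ge0 ?(ltW q0)// addr_ge0// sqr_ge0.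
have mp : 0 < m by rewrite lt_neqAle eq_sym mn0.
have y0 : 0 < m `^ p by exact: powR_gt0.
have mE : m = m `^ p * expR ((1 - p) * ln m).
  by rewrite /powR (negbTE mn0) -expRD -mulrDl addrC subrK mul1r lnK.
have yE : m `^ p = m * expR (- ((1 - p) * ln m)).
  by rewrite {2}mE -mulrA -expRD subrr expR0 mulr1.
have lnm : ln m < m by exact: ln_sublinear.
have lny : - ln m * m `^ p <= 2.
  have -> : - ln m = p^-1 * ln (m `^ p)^-1.
    by rewrite lnV ?posrE// ln_powR mulrN mulrA mulVf ?gt_eqF// mul1r.
  have z1 : ln (m `^ p)^-1 * m `^ p <= 1.
    by rewrite -ler_pdivlMr// div1r ltW// ln_sublinear// invr_gt0.
  rewrite -mulrA (@le_trans _ _ p^-1)//.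
    by rewrite ler_piMr// invr_ge0 ltW.
  by rewrite -[leRHS]invrK lef_pV2 ?posrE// invr_gt0.
rewrite ler_norml; apply/andP; split.
  have := expR_ge1Dx (- ((1 - p) * ln m)) => /(ler_wpM2l m0); rewrite -yE => h.
  have : m * ln m <= b ^+ 2 by rewrite expr2 (le_trans (ler_wpM2l m0 (ltW lnm)))// ler_pM.
  nra.
have := expR_ge1Dx ((1 - p) * ln m) => /(ler_wpM2l (ltW y0)); rewrite -mE => h.
have := sqr_ge0 b.
nra.
Qed.

End PowerBound.

(** * Fréchet coordinates of a copula vector *)

Section CopulaToMaxZonoid.
Context {R : realType} {d : nat}.
Hypothesis d0 : (0 < d)%N.
Notation V := 'rV[R]_d.
Variable N : V -> R.
Hypothesis N_norm : is_norm N.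
Variable K : set V.
Hypotheses (K0 : K 0) (Ke : forall i, K (delta_mx 0 i))
  (Kcube : K `<=` @unit_cube R d).
Notation h := (support_fun K).

(* [powR _ (-1)] is the inverse, with the value 0 at 0; it is used for its measurability. *)
Definition frechet (x : R) : R := if x < 1 then (- ln x) `^ (-1) else 0.

Lemma frechet_ge0 x : 0 <= frechet x.
Proof. by rewrite /frechet; case: ifP => // _; exact: powR_ge0. Qed.

Lemma measurable_frechet : measurable_fun setT frechet.
Proof.
rewrite /frechet; apply: measurable_fun_ifT => //; first exact: measurable_fun_ltr.
apply: (measurableT_comp (@measurable_powR R (-1))).
by apply: measurableT_comp => //; exact: measurable_ln.
Qed.

Lemma frechet_le x b t : x < 1 -> 0 <= b -> 0 < t ->
  (frechet x * b <= t) = (x <= expR (- (t^-1 * b))).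
Proof.
move=> x1 b0 t0; rewrite /frechet x1.
(* For [x <= 0] the logarithm has its default value 0, so [frechet x] is 0 and both inequalities
   hold. *)
have [x0|x0] := leP x 0.
  rewrite ln0// oppr0 powR0 ?oppr_eq0 ?oner_eq0// mul0r (ltW t0).
  by apply/esym; rewrite (le_trans x0)// expR_ge0.
have L0 : 0 < - ln x by rewrite oppr_gt0 ln_lt0// x0.
rewrite powR_inv1 ?(ltW L0)// -ler_pdivlMl ?invr_gt0// invrK.
by rewrite -[x in RHS]lnK ?posrE// ler_expR lerNr ler_pdivrMl// mulrC.
Qed.

Section RandomVector.
Context dsp (T : measurableType dsp).
Variables (P : probability T R) (X : 'I_d -> T -> R).
Hypotheses (mX : forall i, measurable_fun setT (X i))
  (XC : forall u, unit_cube u ->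
    (copula_candidate K u)%:E = P [set w | forall i, X i w <= u 0 i]).

Definition frechet_vec (w : T) : V := \row_i frechet (X i w).
Notation A := frechet_vec.

Lemma measurable_frechet_vec : measurable_fun setT (A : T -> borelV R d).
Proof.
apply: measurable_borelV => i; under eq_fun do rewrite mxE.
exact: measurableT_comp measurable_frechet (mX i).
Qed.

Let below_one : set T := [set w | forall i, X i w < 1].

Let measurable_all (F : 'I_d -> set T) : (forall i, measurable (F i)) ->
  measurable [set w | forall i, F i w].
Proof.
move=> mF; rewrite (_ : [set w | _] = \bigcap_(i in [set: 'I_d]) F i).
  by apply: fin_bigcap_measurable.
by apply/seteqP; split => w wF i; [move=> _|]; exact: wF.
Qed.

Let measurable_below_one : measurable below_one.
Proof.
apply: measurable_all => i; rewrite -[X in measurable X]setTI.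
by apply: measurable_fun_ltr.
Qed.

Let measurable_X_le (u : V) : measurable [set w | forall i, X i w <= u 0 i].
Proof.
apply: (measurable_all (F := fun i => [set w | X i w <= u 0 i])) => i.
by rewrite -[X in measurable X]setTI; apply: measurable_fun_ler.
Qed.

(** [C] equals 1 at [(1, ..., 1)] and the increment bound makes it close to 1 slightly below. This
    discards the event on which [frechet] takes its default value. *)
Let P_below_one : P below_one = 1%E.
Proof.
apply/eqP; rewrite eq_le probability_le1//=.
apply/lee_addgt0Pr => e e0.
(* The bound [1/2] keeps the coordinates [1 - e'] positive. *)
pose e' := Num.min (e / d%:R) 2^-1.
have dR0 : 0 < d%:R :> R by rewrite ltr0n.
have e'0 : 0 < e' by rewrite lt_min divr_gt0//= invr_gt0.
have e'1 : e' < 1 by rewrite (@le_lt_trans _ _ 2^-1) ?ge_min ?lexx ?orbT// invf_lt1// ltr1n.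
pose u : V := const_mx (1 - e').
pose v : V := const_mx 1.
have uc : unit_cube u by move=> i; rewrite mxE subr_ge0 (ltW e'1)/= gerBl ltW.
have uv i : 0 < u 0 i <= v 0 i by rewrite !mxE subr_gt0 e'1/= gerBl ltW.
have v1 i : v 0 i <= 1 by rewrite mxE.
have := copula_candidate_increment K0 Ke Kcube uv v1.
rewrite copula_candidate_pos; last by move=> i; rewrite mxE.
have -> : neg_ln v = 0 *: 0 by apply/rowP => i; rewrite !mxE ln1 oppr0 mul0r.
rewrite (support_funZ K0 Kcube)// mul0r oppr0 expR0.
rewrite (eq_bigr (fun=> e')); last by move=> i _; rewrite !mxE subKr.
rewrite sumr_const card_ord => C1.
rewrite (@le_trans _ _ (copula_candidate K u + e)%:E)//.
  rewrite lee_fin (le_trans C1)// lerD2l -mulr_natr -ler_pdivlMr//.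
  by rewrite ge_min lexx.
rewrite EFinD leeD2r// XC//; apply: le_measure; rewrite ?inE//.
by move=> w /= wu i; rewrite (le_lt_trans (wu i))// mxE ltrBlDr ltrDl.
Qed.

(** Almost surely the event says that [X_i <= exp (- x_i / t)] for all [i], so its probability is
    [C] at that point, that is [exp (- h (x / t))]; homogeneity of [h] concludes. *)
Lemma wmax_law x t : orthant x -> 0 < t ->
  P [set w | wmax x (A w) <= t] = (expR (- (h x / t)))%:E.
Proof.
move=> xO t0; pose u : V := \row_i expR (- (t^-1 * x 0 i)).
have u0 i : 0 < u 0 i by rewrite mxE expR_gt0.
have uc : unit_cube u.
  by move=> i; rewrite (ltW (u0 i))/= mxE expR_le1 oppr_le0 mulr_ge0 ?invr_ge0 ?(ltW t0)// xO.
have Cu : copula_candidate K u = expR (- (h x / t)).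
  rewrite copula_candidate_pos// (_ : neg_ln u = t^-1 *: x).
    by rewrite (support_funZ K0 Kcube) ?invr_ge0 ?(ltW t0)// mulrC.
  by apply/rowP => i; rewrite !mxE expRK opprK.
have mW : measurable [set w | wmax x (A w) <= t].
  rewrite -[X in measurable X]setTI; apply: measurable_fun_ler => //.
  apply: (measurableT_comp (lipschitz_sup_measurable (lipschitz_wmax x d0))).
  exact: measurable_frechet_vec.
have null : P (~` below_one) = 0%E by rewrite probability_setC// P_below_one subee.
have split_null (E : set T) : measurable E -> P E = P (E `&` below_one).
  move=> mE; rewrite (measureDI P mE measurable_below_one).
  rewrite [X in (X + _)%E](_ : _ = 0%E) ?add0e//.
  apply/eqP; rewrite eq_le measure_ge0 andbT -null; apply: le_measure; rewrite ?inE.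
  - exact: measurableD.
  - exact: measurableC.
  - by move=> w [].
rewrite -Cu XC// split_null// [RHS]split_null//; congr (P _).
apply/seteqP; split => w /= [wE w1]; split => //.
  move=> i; rewrite mxE -(frechet_le (w1 i) (xO i) t0).
  by have /wmax_leP/(_ i) := wE; rewrite mxE; apply; exact: ltW.
apply/wmax_leP => [|i]; first exact: ltW.
by rewrite mxE (frechet_le (w1 i) (xO i) t0); have := wE i; rewrite mxE.
Qed.

End RandomVector.
End CopulaToMaxZonoid.

(** * Directions under a change of measure *)

Section Tilting.
Context {R : realType} {d : nat}.
Hypothesis d0 : (0 < d)%N.
Notation V := 'rV[R]_d.
Variable N : V -> R.
Hypothesis N_norm : is_norm N.
Context dsp (T : measurableType dsp).
Variables (P : probability T R) (A : T -> V) (h : V -> R) (e1 : V) (p : R).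
Hypotheses (mA : measurable_fun setT (A : T -> borelV R d))
  (A0 : forall w, orthant (A w)) (h0 : forall x, orthant x -> 0 <= h x)
  (e1O : orthant e1) (he1 : h e1 = 1)
  (law : forall x t, orthant x -> 0 < t ->
    P [set w | wmax x (A w) <= t] = (expR (- (h x / t)))%:E)
  (p01 : 0 < p < 1).

Let p0 : 0 < p. Proof. by case/andP: p01. Qed.

Let measurable_wmax x : measurable_fun setT (fun w => wmax x (A w)).
Proof. exact: measurableT_comp (lipschitz_sup_measurable (lipschitz_wmax x d0)) mA. Qed.

Let measurable_pow (Y : T -> R) : measurable_fun setT Y ->
  measurable_fun setT (fun w => Y w `^ p).
Proof. exact: measurableT_comp (@measurable_powR R p). Qed.

Let e1_moment : \bar R := (\int[P]_w (wmax e1 (A w) `^ p)%:E)%E.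

Lemma wmax_moment x : orthant x ->
  (\int[P]_w (wmax x (A w) `^ p)%:E = (h x `^ p)%:E * e1_moment)%E.
Proof.
move=> xO; have hx0 := h0 xO.
rewrite /e1_moment -ge0_integralZl_EFin//; last 3 first.
- by move=> w _; rewrite lee_fin powR_ge0.
- by apply/measurable_EFinP; exact: measurable_pow.
- exact: powR_ge0.
under [RHS]eq_integral do rewrite -EFinM -powRM ?wmax_ge0//.
apply: eq_expectation_tail => [| |w|w|r r0].
- exact: measurable_pow.
- by apply: measurable_pow; apply: measurable_funM.
- exact: powR_ge0.
- exact: powR_ge0.
have s0 : 0 < r `^ p^-1 by exact: powR_gt0.
under eq_set do rewrite powR_le_invE ?wmax_ge0 ?(ltW r0)//.
rewrite law//.
under eq_set do rewrite powR_le_invE ?mulr_ge0 ?wmax_ge0 ?(ltW r0)//.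
(* Here both distribution functions are 1 at every positive threshold, and no division by [h x] is
   possible. *)
have [hx|hxn] := eqVneq (h x) 0.
  rewrite hx mul0r oppr0 expR0 (_ : [set _ | _] = setT) ?probability_setT//.
  by apply/seteqP; split => w //= _; rewrite mul0r ltW.
have hxp : 0 < h x by rewrite lt_neqAle eq_sym hxn.
under eq_set do rewrite -ler_pdivlMl//.
by rewrite law ?mulr_gt0 ?invr_gt0// he1 div1r invfM invrK.
Qed.

Lemma e1_moment_finite : (e1_moment < +oo)%E.
Proof.
apply: powR_expectation_finite => //; first by move=> w; exact: wmax_ge0.
by move=> r r0; rewrite law// he1 div1r.
Qed.

Lemma e1_moment_gt0 : (0 < e1_moment)%E.
Proof.
have mS : measurable (~` [set w | wmax e1 (A w) <= 1]).
  apply: measurableC; rewrite -[X in measurable X]setTI.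
  exact: measurable_fun_ler.
apply: (@lt_le_trans _ _ (P (~` [set w | wmax e1 (A w) <= 1]))).
  rewrite probability_setC; last by rewrite -[X in measurable X]setCK; exact: measurableC.
  by rewrite law// he1 divr1 -EFinB lte_fin subr_gt0 expR_lt1 oppr_lt0.
rewrite -[leLHS]mul1e -integral_cst//.
rewrite /e1_moment integral_mkcond; apply: ge0_le_integral => //.
- by move=> w _; rewrite patchE; case: ifP.
- by apply/(measurable_restrictT _ _).1 => //; exact: measurable_cst.
- by apply/measurable_EFinP; exact: measurable_pow.
move=> w _; rewrite patchE; case: ifPn => [/set_mem/= /negP|_]; last first.
  by rewrite lee_fin powR_ge0.
rewrite -ltNge lee_fin => M1; rewrite -[leLHS](powRr0 (wmax e1 (A w))).
by rewrite ler_powR ?(ltW M1)// ltW.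
Qed.

Let mN : measurable_fun setT (fun w => N (A w)).
Proof.
exact: measurableT_comp (lipschitz_sup_measurable (lipschitz_ref_norm N_norm)) mA.
Qed.

Let N_moment : \bar R := (\int[P]_w (N (A w) `^ p)%:E)%E.

Let N_moment_finite : (N_moment < +oo)%E.
Proof.
pose one : V := const_mx 1.
have oneO : orthant one by move=> i; rewrite mxE.
have s0 : 0 <= norm_sum N by apply: sumr_ge0 => i _; exact: ref_norm_ge0.
have Nle w : N (A w) <= norm_sum N * wmax one (A w).
  rewrite (le_trans (ref_norm_le_sum N_norm _))// /norm_sum mulr_suml.
  apply: ler_sum => i _; rewrite mulrC ler_wpM2l ?ref_norm_ge0// ger0_norm ?A0//.
  by have := wmax_ge one (A w) i; rewrite mxE mulr1.
apply: (@le_lt_trans _ _ ((norm_sum N `^ p)%:E * ((h one `^ p)%:E * e1_moment))%E).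
  rewrite -wmax_moment// -ge0_integralZl_EFin//; last 3 first.
  - by move=> w _; rewrite lee_fin powR_ge0.
  - by apply/measurable_EFinP; exact: measurable_pow.
  - exact: powR_ge0.
  apply: ge0_le_integral => //.
  - by move=> w _; rewrite lee_fin powR_ge0.
  - by apply/measurable_EFinP; exact: measurable_pow.
  - apply/measurable_EFinP; apply: measurable_funM => //; exact: measurable_pow.
  move=> w _; rewrite lee_fin -powRM ?wmax_ge0//.
  by apply: ge0_ler_powR (Nle w); rewrite ?nnegrE ?mulr_ge0 ?wmax_ge0 ?ref_norm_ge0// ltW.
rewrite lte_mul_pinfty ?lee_fin ?powR_ge0//.
by rewrite lte_mul_pinfty ?lee_fin ?powR_ge0// e1_moment_finite.
Qed.

(** [M_(e_1)] is at most a multiple of [N(A)], so a vanishing moment of [N(A)] would contradict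
    [e1_moment_gt0]. *)
Let N_moment_gt0 : (0 < N_moment)%E.
Proof.
have [c c0 cN] := ref_norm_lower d0 N_norm.
pose s := \sum_i e1 0 i.
have s0 : 0 <= s by apply: sumr_ge0 => i _; exact: e1O.
have Mle w : wmax e1 (A w) <= s / c * N (A w).
  apply/wmax_leP => [|i]; first by rewrite mulr_ge0 ?divr_ge0 ?ref_norm_ge0// ltW.
  rewrite -mulrA mulrC ler_pM ?A0 ?e1O//.
    by rewrite /s (bigD1 i)//= lerDl; apply: sumr_ge0 => j _; exact: e1O.
  rewrite mulrC ler_pdivlMr// mulrC (le_trans _ (cN _ i))//.
  by rewrite ler_wpM2l ?(ltW c0)// ler_norm.
rewrite lt_neqAle integral_ge0 ?andbT; last by move=> w _; rewrite lee_fin powR_ge0.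
apply/eqP => N0; have := e1_moment_gt0; rewrite ltNge => /negP; apply.
apply: (@le_trans _ _ (((s / c) `^ p)%:E * N_moment)%E); last by rewrite -N0 mule0.
rewrite -ge0_integralZl_EFin//; last 3 first.
- by move=> w _; rewrite lee_fin powR_ge0.
- by apply/measurable_EFinP; exact: measurable_pow.
- exact: powR_ge0.
apply: ge0_le_integral => //.
- by move=> w _; rewrite lee_fin powR_ge0.
- by apply/measurable_EFinP; exact: measurable_pow.
- apply/measurable_EFinP; apply: measurable_funM => //; exact: measurable_pow.
move=> w _; rewrite lee_fin -powRM ?divr_ge0 ?(ltW c0) ?ref_norm_ge0//.
apply: ge0_ler_powR (Mle w); rewrite ?nnegrE ?wmax_ge0 ?(ltW p0)//.
by rewrite mulr_ge0 ?divr_ge0 ?(ltW c0) ?ref_norm_ge0.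
Qed.

(* The law of A / N(A) under the measure with density proportional to N(A)^p. *)
Lemma tilted_direction_law (B : R) : 0 <= B -> ref_sphere N `<=` box B ->
  exists2 Q : probability (borelV R d) R, Q (~` box B) = 0%E &
  (exists r, forall x, orthant x ->
    \int[Q]_(a in (box B : set (borelV R d))) (wmax x a `^ p) = h x `^ p * r) /\
  \int[Q]_(a in (box B : set (borelV R d))) `|N a - 1| = 0.
Proof.
move=> B0 SB; pose c := fine N_moment.
have cE : N_moment = c%:E by rewrite fineK// ge0_fin_numE// ltW.
have c0 : 0 < c by rewrite -lte_fin -cE.
pose g w := c^-1 * N (A w) `^ p.
have mg : measurable_fun setT g by apply: measurable_funM => //; exact: measurable_pow.
have g0 w : 0 <= g w by rewrite mulr_ge0 ?powR_ge0// invr_ge0 ltW.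
have g1 : (\int[P]_w (g w)%:E = 1)%E.
  under eq_integral do rewrite EFinM.
  rewrite ge0_integralZl_EFin ?invr_ge0 ?(ltW c0)//.
  - by rewrite -/N_moment cE -EFinM mulVf// gt_eqF.
  - by move=> w _; rewrite lee_fin powR_ge0.
  - by apply/measurable_EFinP; exact: measurable_pow.
have [P' P'E] := density_exists mg g0 g1.
(* Where [N (A w) = 0] this is the zero vector, which lies in the box though not on the sphere; the
   density [g] vanishes there. *)
pose theta w : V := N (A w) `^ (-1) *: A w.
have mtheta : measurable_fun setT (theta : T -> borelV R d).
  apply: measurable_borelV => i; under eq_fun do rewrite mxE.
  apply: measurable_funM.
    exact: measurableT_comp (@measurable_powR R (-1)) mN.
  exact: measurableT_comp (measurable_coord i) mA.
have A_eq0 w : N (A w) = 0 -> A w = 0 by case: N_norm => NE _ _; exact: NE.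
have thetaE w : N (A w) != 0 -> theta w = (N (A w))^-1 *: A w.
  by move=> _; rewrite /theta powR_inv1 ?ref_norm_ge0.
have Ntheta w : N (A w) != 0 -> N (theta w) = 1.
  move=> NA; rewrite thetaE// (ref_normZ N_norm) ger0_norm ?mulVf//.
  by rewrite invr_ge0 ref_norm_ge0.
have theta_box w : box B (theta w).
  have [NA|NA] := eqVneq (N (A w)) 0.
    by move=> i; rewrite /theta (A_eq0 _ NA) scaler0 mxE lexx.
  apply: SB; split; last exact: Ntheta.
  by move=> i; rewrite mxE mulr_ge0 ?powR_ge0// A0.
have [Q QE] := law_exists P' mtheta.
have QB : Q (~` box B) = 0%E.
  rewrite QE (_ : _ @^-1` _ = set0) ?measure0//.
  by apply/seteqP; split => w //=; apply; exact: theta_box.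
have mB := @measurable_box R d B.
have QF (F : V -> R) M : measurable_fun setT (F : borelV R d -> R) ->
    (forall a, 0 <= F a) -> (forall a, box B a -> `|F a| <= M) ->
    \int[Q]_(a in (box B : set (borelV R d))) F a =
    fine (\int[P]_w (F (theta w) * g w)%:E)%E.
  move=> mF F0 FM; rewrite (Rintegral_law mtheta QE mB mF theta_box FM) /Rintegral.
  rewrite (P'E (F \o theta))//; first exact: measurableT_comp mF mtheta.
  by move=> w; exact: F0.
exists Q => //; split; last first.
  (* The sphere condition is recorded through a Lipschitz function, since [selection] can pass such
     a statement to the limit. *)
  have fN : lipschitz_sup (norm_sum N) (fun a : V => `|N a - 1|).
    move=> x y e xy; apply: le_trans (lipschitz_ref_norm N_norm xy).
    by rewrite (le_trans (ler_dist_dist _ _))// opprB addrA subrK.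
  rewrite (QF _ _ (lipschitz_sup_measurable fN) _ (fun a => lipschitz_sup_bounded fN))//.
  under eq_integral => w _.
    rewrite (_ : _ * g w = 0); last first.
      have [NA|NA] := eqVneq (N (A w)) 0.
        by rewrite /g NA powR0 ?gt_eqF// mulr0 mulr0.
      by rewrite Ntheta// subrr normr0 mul0r.
    over.
  by rewrite integral0.
(* The factor [N(A)^p] of the density cancels the normalisation of the direction, so the integrand
   is [wmax x A ^ p] up to [c^-1]; [wmax_moment] then makes the constant the ratio of the moments of
   [M_(e_1)] and [N(A)]. *)
exists (c^-1 * fine e1_moment) => x xO.
have fx := lipschitz_wmax x d0.
rewrite (QF (fun a => wmax x a `^ p) ((`|wmax x 0| + (\sum_i `|x 0 i|) * B) `^ p)).
- under eq_integral => w _.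
    rewrite (_ : _ * g w = c^-1 * wmax x (A w) `^ p); last first.
      have [NA|NA] := eqVneq (N (A w)) 0.
        rewrite /g NA powR0 ?gt_eqF// mulr0 mulr0 (A_eq0 _ NA) -(scale0r (0 : V)).
        by rewrite wmaxZr// mul0r powR0 ?gt_eqF// mulr0.
      have Np : 0 < N (A w) by rewrite lt_neqAle eq_sym NA ref_norm_ge0.
      rewrite thetaE// wmaxZr ?invr_ge0 ?(ltW Np)// /g mulrCA; congr (_ * _).
      rewrite powRM ?invr_ge0 ?wmax_ge0 ?(ltW Np)// mulrAC -powRM ?invr_ge0 ?(ltW Np)//.
      by rewrite mulVf// powR1 mul1r.
    rewrite EFinM; over.
  rewrite ge0_integralZl_EFin ?invr_ge0 ?(ltW c0)//; last 2 first.
  - by move=> w _; rewrite lee_fin powR_ge0.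
  - by apply/measurable_EFinP; exact: measurable_pow.
  rewrite wmax_moment// -[e1_moment]fineK; last first.
    by rewrite ge0_fin_numE ?e1_moment_finite// ltW// e1_moment_gt0.
  by rewrite -!EFinM /= mulrCA.
- exact: measurableT_comp (@measurable_powR R p) (lipschitz_sup_measurable fx).
- by move=> a; exact: powR_ge0.
- move=> a aB; rewrite ger0_norm ?powR_ge0//; apply: ge0_ler_powR; rewrite ?nnegrE ?wmax_ge0 ?(ltW p0)//.
    by rewrite addr_ge0// mulr_ge0// sumr_ge0.
  by rewrite (le_trans (ler_norm _))//; exact: lipschitz_sup_bounded.
Qed.

End Tilting.

(** * Limit of the tilted directions *)

Section LimitSpectralMeasure.
Context {R : realType} {d : nat}.
Hypothesis d0 : (0 < d)%N.
Notation V := 'rV[R]_d.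
Variable N : V -> R.
Hypothesis N_norm : is_norm N.
Variable K : set V.
Hypotheses (K0 : K 0) (Ke : forall i, K (delta_mx 0 i))
  (Kcube : K `<=` @unit_cube R d).
Notation h := (support_fun K).

Lemma wmax_le_box (B : R) (x a : V) : box B a -> wmax x a <= (\sum_i `|x 0 i|) * B.
Proof.
move=> aB; have := lipschitz_sup_bounded (lipschitz_wmax x d0) aB.
have -> : wmax x 0 = 0 by rewrite -(scale0r (0 : V)) wmaxZr// mul0r.
rewrite normr0 add0r.
by apply: le_trans; exact: ler_norm.
Qed.

(** The constant of [powR_near_id] when [b] is the bound of [wmax y] on the box. *)
Definition power_gap (B : R) (y : V) : R := ((\sum_i `|y 0 i|) * B) ^+ 2 + 2.

Lemma wmax_moment_limit (Q : probability (borelV R d) R) (B p r : R) (e1 x : V) :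
  0 <= B -> Q (~` box B) = 0%E -> 2^-1 <= p < 1 -> orthant e1 -> h e1 = 1 -> orthant x ->
  (forall y, orthant y ->
    \int[Q]_(a in (box B : set (borelV R d))) (wmax y a `^ p) = h y `^ p * r) ->
  `|\int[Q]_(a in (box B : set (borelV R d))) (wmax x a - h x * wmax e1 a)| <=
  (power_gap B x + (h x ^+ 2 + 2) * ((\sum_i `|e1 0 i|) * B + power_gap B e1) +
    h x * power_gap B e1) *
    (1 - p).
Proof.
move=> B0 QB p21 e1O he1 xO moment; pose kappa := power_gap B; have /andP[p2 p1] := p21.
have p0 : 0 < p by rewrite (lt_le_trans _ p2)// invr_gt0.
have mB := @measurable_box R d B.
have Bfin : (Q (box B) < +oo)%E := le_lt_trans (probability_le1 Q mB) (ltry 1).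
have QB1 : fine (Q (box B)) <= 1 by rewrite -lee_fin fineK ?fin_num_measure//; exact: probability_le1.
have b0 y : 0 <= (\sum_i `|y 0 i|) * B by rewrite mulr_ge0// sumr_ge0.
have k0 y : 0 <= kappa y by rewrite addr_ge0// sqr_ge0.
have Mi y : Q.-integrable (box B) (EFin \o wmax y).
  exact: lipschitz_sup_integrable B0 Bfin (lipschitz_wmax y d0).
have Mpi y : Q.-integrable (box B) (EFin \o (fun a => wmax y a `^ p)).
  apply: (@bounded_integrable _ _ _ _ _ mB Bfin _ (((\sum_i `|y 0 i|) * B) `^ p)).
    apply: measurable_funTS.
    exact: measurableT_comp (@measurable_powR R p)
      (lipschitz_sup_measurable (lipschitz_wmax y d0)).
  move=> a aB; rewrite ger0_norm ?powR_ge0//.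
  by apply: ge0_ler_powR; rewrite ?nnegrE ?wmax_ge0 ?b0 ?(ltW p0)//; exact: wmax_le_box.
have close y : orthant y ->
    `|h y `^ p * r - \int[Q]_(a in (box B : set (borelV R d))) wmax y a| <= kappa y * (1 - p).
  move=> yO; rewrite -moment//; apply: (le_trans (le_dist_Rintegral mB Bfin (Mpi y) (Mi y)
    (e := kappa y * (1 - p)) _)).
    move=> a aB; apply: powR_near_id => //.
    by rewrite wmax_ge0; exact: wmax_le_box.
  by rewrite ler_piMr// mulr_ge0 ?k0// subr_ge0 ltW.
pose I y := \int[Q]_(a in (box B : set (borelV R d))) wmax y a.
have I_le : `|I e1| <= (\sum_i `|e1 0 i|) * B.
  have I0 : 0 <= I e1 by apply: Rintegral_ge0 => a _; exact: wmax_ge0.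
  rewrite ger0_norm//; apply: (@le_trans _ _
      (\int[Q]_(a in (box B : set (borelV R d))) ((\sum_i `|e1 0 i|) * B))).
    apply: le_Rintegral => //.
      by apply: (@bounded_integrable _ _ _ _ _ mB Bfin _ `|(\sum_i `|e1 0 i|) * B|).
    by move=> a; exact: wmax_le_box.
  by rewrite Rintegral_cst// ler_piMr.
have hx0 := support_fun_ge0 K0 Kcube x.
have close1 := close _ e1O; rewrite he1 powR1 mul1r -/(I e1) in close1.
have closex := close _ xO; rewrite -/(I x) in closex.
have hp : `|h x `^ p - h x| <= (h x ^+ 2 + 2) * (1 - p).
  by apply: powR_near_id => //; rewrite hx0 lexx.
(* As [h e1 = 1], [r] is the [p]-th moment of [wmax e1], close to a mean bounded on the box; this
   bound is uniform in [p]. *)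
have rb : `|r| <= (\sum_i `|e1 0 i|) * B + kappa e1.
  rewrite -[r](subrK (I e1)) (le_trans (ler_normD _ _))// addrC lerD//.
  apply: le_trans close1 _; rewrite ler_piMr ?k0//.
  by rewrite gerBl ltW.
have -> : \int[Q]_(a in (box B : set (borelV R d))) (wmax x a - h x * wmax e1 a) =
    I x - h x * I e1.
  rewrite RintegralB//; first by rewrite RintegralZl.
  have := integrableZl mB (h x) (Mi e1); exact: eq_integrable.
have -> : I x - h x * I e1 =
    - (h x `^ p * r - I x) + (h x `^ p - h x) * r + h x * (r - I e1) by ring.
rewrite (le_trans (ler_normD _ _))// [leRHS]mulrDl lerD//.
  rewrite (le_trans (ler_normD _ _))// [leRHS]mulrDl normrN lerD//.
  by rewrite normrM mulrAC ler_pM.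
by rewrite normrM (ger0_norm hx0) -mulrA ler_wpM2l.
Qed.

Lemma copula_is_max_zonoid : is_copula (copula_candidate K) -> max_zonoid N K.
Proof.
move=> [dsp [T [P [X [mX _ XC]]]]]; have [B Bp SB] := ref_sphere_box d0 N_norm.
have B0 := ltW Bp; have mB := @measurable_box R d B.
pose e1 : V := delta_mx 0 (Ordinal d0).
have e1O : orthant e1 by move=> i; rewrite mxE; case: (_ && _).
have he1 : h e1 = 1 by rewrite -[e1]scale1r (support_fun_delta K0 Ke Kcube).
pose A := frechet_vec X.
have mA : measurable_fun setT (A : T -> borelV R d) by exact: measurable_frechet_vec.
have AO w : orthant (A w) by move=> i; rewrite mxE; exact: frechet_ge0.
have law x t : orthant x -> 0 < t ->
    P [set w | wmax x (A w) <= t] = (expR (- (h x / t)))%:E.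
  exact: (wmax_law d0 K0 Ke Kcube mX XC).
(* The shift by 2 gives [p n >= 1/2], as [powR_near_id] demands. *)
pose p (n : nat) : R := 1 - n.+2%:R^-1.
have p21 n : 2^-1 <= p n < 1.
  rewrite /p ltrBlDr ltrDl invr_gt0 ltr0n andbT lerBrDr -lerBrDl.
  rewrite (_ : 1 - 2^-1 = 2^-1 :> R); last by lra.
  by rewrite lef_pV2 ?posrE// ler_nat.
have p01 n : 0 < p n < 1.
  by have /andP[p2 ->] := p21 n; rewrite (lt_le_trans _ p2)// invr_gt0.
have /choice[Q QP] : forall n, exists Q : probability (borelV R d) R,
    [/\ Q (~` box B) = 0%E,
      exists r, forall x, orthant x ->
        \int[Q]_(a in (box B : set (borelV R d))) (wmax x a `^ p n) = h x `^ p n * r &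
      \int[Q]_(a in (box B : set (borelV R d))) `|N a - 1| = 0].
  move=> n; have [Q QB [Qr QN]] := tilted_direction_law d0 N_norm mA AO
    (fun x _ => support_fun_ge0 K0 Kcube x) e1O he1 law (p01 n) B0 SB.
  by exists Q.
have QB n : Q n (~` box B) = 0%E by have [] := QP n.
have [L LB Lsel] := @selection R d d0 B B0 Q QB.
have Lfin : (L (box B) < +oo)%E := le_lt_trans (probability_le1 L mB) (ltry 1).
pose rho := \int[L]_(a in (box B : set (borelV R d))) wmax e1 a.
have Mi x : L.-integrable (box B) (EFin \o wmax x).
  exact: lipschitz_sup_integrable B0 Lfin (lipschitz_wmax x d0).
have LM x : orthant x ->
    \int[L]_(a in (box B : set (borelV R d))) wmax x a = h x * rho.
  move=> xO; have hx0 := support_fun_ge0 K0 Kcube x.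
  have [C CP] : exists C, forall n,
      `|\int[Q n]_(a in (box B : set (borelV R d))) (wmax x a - h x * wmax e1 a)| <=
      C * (1 - p n).
    eexists => n; have [_ [r Qr] _] := QP n.
    exact: (wmax_moment_limit B0 (QB n) (p21 n) e1O he1 xO Qr).
  have C0 : (fun n => C * (1 - p n)) @ \oo --> 0.
    rewrite -(mulr0 C); apply: cvgM; first exact: cvg_cst.
    rewrite (_ : (fun n => 1 - p n) = (fun n => n.+2%:R^-1)); last first.
      by apply/funext => n; rewrite /p subKr.
    have := @cvg_harmonic R; rewrite -cvg_shiftS; exact.
  (* Neither [p n] nor the unknown constant occurs in [f], so its integrals, of order [1 - p n],
     have limit 0 under [L], with one bound from each side. *)
  pose f a := wmax x a - h x * wmax e1 a.
  have fk : lipschitz_sup (\sum_i `|x 0 i| + h x * \sum_i `|e1 0 i|) f.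
    move=> a b e ab; rewrite (_ : f a - f b =
      (wmax x a - wmax x b) - h x * (wmax e1 a - wmax e1 b)); last by rewrite /f; ring.
    rewrite (le_trans (ler_normB _ _))// mulrDl lerD//.
      exact: lipschitz_wmax.
    by rewrite normrM ger0_norm// -mulrA ler_wpM2l//; exact: lipschitz_wmax.
  have f_le : \int[L]_(a in (box B : set (borelV R d))) f a <= 0.
    by apply: Lsel fk _ C0 => n; exact: le_trans (ler_norm _) (CP n).
  have f_ge : 0 <= \int[L]_(a in (box B : set (borelV R d))) f a.
    apply: (selection_ge B0 Lsel fk _ (c := fun n => - (C * (1 - p n)))) => [n|].
      by have := CP n; rewrite ler_norml => /andP[].
    by rewrite -oppr0; exact: cvgN.
  have fE : \int[L]_(a in (box B : set (borelV R d))) f a =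
      \int[L]_(a in (box B : set (borelV R d))) wmax x a - h x * rho.
    rewrite RintegralB//; first by rewrite RintegralZl.
    have := integrableZl mB (h x) (Mi e1); exact: eq_integrable.
  by apply/eqP; rewrite -subr_eq0 -fE eq_le f_le f_ge.
have LN : \int[L]_(a in (box B : set (borelV R d))) `|N a - 1| <= 0.
  have fN : lipschitz_sup (norm_sum N) (fun a : V => `|N a - 1|).
    move=> x y e xy; apply: le_trans (lipschitz_ref_norm N_norm xy).
    by rewrite (le_trans (ler_dist_dist _ _))// opprB addrA subrK.
  apply: (Lsel _ _ (fun=> 0) _ fN) => [n|]; last exact: cvg_cst.
  by have [_ _ ->] := QP n.
have mS := measurable_ref_sphere N_norm.
have fN : lipschitz_sup (norm_sum N) (fun a : V => N a - 1).
  by move=> x y e xy; rewrite opprB addrA subrK; exact: lipschitz_ref_norm.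
have Ni : L.-integrable (box B) (EFin \o (fun a : V => `|N a - 1|)).
  exact: integrable_norm (lipschitz_sup_integrable B0 Lfin fN).
(* A nonnegative function with integral 0 vanishes almost everywhere: [N a = 1] for almost every [a]
   of the box, and points of the box are in the orthant. *)
have LS : L (~` ref_sphere N) = 0%E.
  have : (\int[L]_(a in (box B : set (borelV R d))) `|(N a - 1)%:E| = 0)%E.
    apply/eqP; rewrite eq_le integral_ge0 ?andbT; last by move=> a _; exact: abse_ge0.
    by rewrite -lee_fin fineK ?integrable_fin_num in LN.
  have mN : measurable_fun (box B : set (borelV R d)) (fun a : V => (N a - 1)%:E).
    by apply/measurable_EFinP/measurable_funTS; exact: lipschitz_sup_measurable fN.
  move/(ae_eq_integral_abs L mB mN) => [Z [mZ LZ subZ]].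
  have mCB : measurable (~` box B : set (borelV R d)) by exact: measurableC.
  have mCS : measurable (~` ref_sphere N : set (borelV R d)) by exact: measurableC.
  apply/eqP; rewrite eq_le measure_ge0 andbT.
  apply: (@le_trans _ _ (L ((~` box B) `|` Z))).
    apply: le_measure; rewrite ?inE//; first exact: measurableU.
    move=> a aS; have [aB|aB] := pselect (box B a); [right|by left].
    apply: subZ => /= aZ; apply: aS; split; first by move=> i; have /andP[] := aB i.
    by have [/eqP] := aZ aB; rewrite subr_eq0 => /eqP.
  apply: (le_trans (measureU2 _ _ _)) => //.
  rewrite [X in (X + _)%E](_ : _ = 0%E); last exact: LB.
  by rewrite [X in (_ + X)%E](_ : _ = 0%E) ?adde0//; exact: LZ.
have LS1 : L (ref_sphere N) = 1%E.
  by rewrite -(setCK (ref_sphere N)) probability_setC ?LS ?sube0//; exact: measurableC.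
have LB1 : fine (L (box B)) = 1.
  by rewrite -(setCK (box B)) probability_setC ?LB ?sube0//; exact: measurableC.
have rho0 : 0 < rho.
  rewrite lt_neqAle Rintegral_ge0 ?andbT; last by move=> a _; exact: wmax_ge0.
  (* If [rho] were 0, the integral of the largest coordinate would be 0. Integrating
     [1 <= |N a - 1| + N a], with [N a] at most a multiple of that coordinate, would give
     [1 <= 0]. *)
  apply/eqP => /esym rho0; pose one : V := const_mx 1.
  have oneO : orthant one by move=> i; rewrite mxE.
  have := LM _ oneO; rewrite rho0 mulr0 => LM1.
  have si : L.-integrable (box B) (EFin \o (fun a => norm_sum N * wmax one a)).
    have := integrableZl mB (norm_sum N) (Mi one); exact: eq_integrable.
  have : \int[L]_(a in (box B : set (borelV R d))) (1 : R) <=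
      \int[L]_(a in (box B : set (borelV R d))) (`|N a - 1| + norm_sum N * wmax one a).
    apply: le_Rintegral => //.
    - by apply: (@bounded_integrable _ _ _ _ _ mB Lfin _ 1) => // a _; rewrite normr1.
    - by have := integrableD mB Ni si; exact: eq_integrable.
    move=> a aB; have Na : N a <= norm_sum N * wmax one a.
      rewrite (le_trans (ref_norm_le_sum N_norm _))// /norm_sum mulr_suml.
      apply: ler_sum => i _; have /andP[ai _] := aB i.
      rewrite mulrC ler_wpM2l ?ref_norm_ge0// ger0_norm//.
      by have := wmax_ge one a i; rewrite mxE mulr1.
    rewrite -lerBlDr; apply: le_trans (_ : 1 - N a <= _); first by rewrite lerB.
    by rewrite distrC ler_norm.
  rewrite Rintegral_cst// LB1 RintegralD// RintegralZl// LM1 mulr0 addr0 mulr1.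
  by move=> /le_trans/(_ LN); rewrite ler10.
have rhoi : 0 <= rho^-1 by rewrite invr_ge0 ltW.
(* Under [L] the integral of [wmax x] is [h x * rho]; dividing by [rho] removes the factor. *)
exists (mscale (NngNum rhoi) L); split.
- rewrite /mscale/=; apply: lte_mul_pinfty => //.
  exact: le_lt_trans (probability_le1 L measurableT) (ltry 1).
- by suff : (rho^-1%:E * L (~` ref_sphere N) = 0)%E by []; rewrite LS mule0.
- suff : (rho^-1%:E * L (ref_sphere N) != 0)%E by [].
  by rewrite LS1 mule1 eqe invr_eq0 gt_eqF.
move=> x xO; rewrite ge0_integral_mscale//; last 2 first.
- apply/measurable_EFinP/measurable_funTS.
  exact: lipschitz_sup_measurable (lipschitz_wmax x d0).
- by move=> a _; rewrite lee_fin; exact: wmax_ge0.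
have Si : L.-integrable (ref_sphere N) (EFin \o wmax x) by exact: integrableS mB mS SB (Mi x).
rewrite -[X in (_ * X)%E]fineK; last exact: integrable_fin_num Si.
rewrite -[fine _]/(\int[L]_(a in (ref_sphere N : set (borelV R d))) wmax x a).
have LT : (L setT < +oo)%E by rewrite probability_setT ltry.
rewrite (Rintegral_ref_sphere N_norm SB B0 LT LS (lipschitz_wmax x d0)) LM//.
by rewrite -EFinM /= mulrCA mulVf ?mulr1// gt_eqF.
Qed.

End LimitSpectralMeasure.

Theorem theorem5p1 (R : realType) (d : nat) (N : 'rV[R]_d -> R)
    (K : set 'rV[R]_d) :
  (0 < d)%N -> is_norm N ->
  compact K -> convex_set K ->
  conv_hull_set (@simplex_vertices R d) `<=` K -> K `<=` @unit_cube R d ->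
  (is_copula (copula_candidate K) <-> max_zonoid N K).
Proof.
move=> d0 N_norm _ _ hullK Kcube.
have vK v : simplex_vertices v -> K v by move=> vv; apply: hullK => C _; apply.
have K0 : K 0 by apply: vK; left.
have Ke i : K (delta_mx 0 i) by apply: vK; right; exists i.
by split; [exact: copula_is_max_zonoid|exact: max_zonoid_is_copula].
Qed.
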